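(* Let $k$ be a commutative ring, let $\mathcal C$ and $\mathcal D$ be $k$-linear Frobenius categories, and let $L:\mathcal D\to\mathcal C$ and $R:\mathcal C\to\mathcal D$ be exact functors with $L$ left adjoint to $R$ and counit $\delta_M:LRM\to M$. If $R(\delta_M)$ has injective kernel for each object $M$ of $\mathcal C$, then $\mathcal C$ admits a model structure in which: a) the cofibrations are the inflations with cokernel of the form $LN$ ($N\in\mathcal D$) and their retracts; b) the fibrations are the morphisms with the right lifting property with respect to $0\to PLN$ for every object $N$ of $\mathcal D$; c) the class of weak equivalences, $\mathcal W_{\mathcal C}$, is formed by the morphisms $f$ such that $R(f)$ is a stable isomorphism. With respect to this model structure every object is fibrant, and an object is cofibrant if and only if it is a direct summand of some $LN$, $N\in\mathcal D$. Also: d) the trivial cofibrations are the inflations with cokernel of the form $PLN$ ($N\in\mathcal D$) and their retracts; e) the trivial fibrations are the morphisms with the right lifting property with respect to the morphisms $S^{-1}LN\to PLN$ for every object $N$ of $\mathcal D$. Moreover, the localization of $\mathcal C$ with respect to the weak equivalences is the triangle quotient of the stable category $\underline{\mathcal C}$ by the full triangulated subcategory whose objects are the $M$ such that $\underline{\mathcal C}(LN,M)=0$ for all $N$ in $\mathcal D$, and it is triangle equivalent to $\mathrm{Tria}(\{LN\}_{N\in\mathcal D})$, the smallest full triangulated subcategory of $\underline{\mathcal C}$ containing all $LN$, $N\in\mathcal D$, and closed under coproducts. The objects of this subcategory are precisely the direct summands, in $\underline{\mathcal C}$, of the images $LN$ of objects $N$ of $\mathcal D$ under $L$.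
   Context: An exact category (in the sense of Quillen) is an additive category with a distinguished class of kernel-cokernel pairs $X\xrightarrow{i}Y\xrightarrow{p}Z$ called conflations ($i$ is called an inflation, $p$ a deflation) satisfying the usual axioms. A functor between exact categories is exact if it is additive and preserves conflations. A Frobenius category is an exact category with enough injectives and enough projectives (relative to conflations) in which injectives and projectives coincide; its stable category $\underline{\mathcal C}$ is the quotient by the ideal of morphisms factoring through a projective-injective object, a triangulated category whose shift $S$ is given by choosing for each $X$ a conflation $X\xrightarrow{i_X}IX\xrightarrow{p_X}SX$ with $IX$ injective. Similarly, for each $X$ one chooses a conflation $S^{-1}X\to PX\to X$ with $PX$ projective; $PLN$ means $P(LN)$ and $S^{-1}LN\to PLN$ is the inflation of this conflation for $X=LN$. A stable isomorphism is a morphism whose image in the stable category is an isomorphism. ''$R(\delta_M)$ has injective kernel'' means that the morphism $R(\delta_M)$ (a retraction, by the triangle identities) has a kernel which is an injective object. A model structure on a category consists of three classes of morphisms (weak equivalences, cofibrations, fibrations) such that: weak equivalences satisfy 2-out-of-3; the three classes are closed under retracts; trivial cofibrations (= cofibrations that are weak equivalences) have the left lifting property with respect to fibrations, and cofibrations have it with respect to trivial fibrations (= fibrations that are weak equivalences); every morphism factors as a cofibration followed by a trivial fibration and as a trivial cofibration followed by a fibration. Functorial factorizations and (co)limits are not required. An object is cofibrant (fibrant) if $0\to X$ is a cofibration ($X\to 0$ is a fibration).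
   Formalization: Clauses b) and d) are stated under the condition that each chosen PLN is a direct summand of some LN'; for an arbitrary choice they fail (D = 0 with P(0) nonzero), and the condition is necessary and is met by PLN = L(PN). *)

(* Defs.v *)
From HB Require Import structures.
From mathcomp Require Import all_boot all_algebra.
From mathcomp Require Import boolp.

Set Implicit Arguments.
Unset Strict Implicit.
Unset Printing Implicit Defensive.

Import GRing.Theory.
Local Open Scope ring_scope.
Local Open Scope quotient_scope.

Record category := Category {
  obj :> Type;
  mor : obj -> obj -> Type;
  idm : forall X, mor X X;
  mcomp : forall X Y Z, mor Y Z -> mor X Y -> mor X Z;
  mcompA : forall X Y Z T (h : mor Z T) (g : mor Y Z) (f : mor X Y),
    mcomp h (mcomp g f) = mcomp (mcomp h g) f;
  mcomp1m : forall X Y (f : mor X Y), mcomp (idm Y) f = f;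
  mcompm1 : forall X Y (f : mor X Y), mcomp f (idm X) = f }.

Arguments idm {c} X.
Arguments mcomp {c X Y Z} g f.

Notation "g \oc f" := (mcomp g f) (at level 40, left associativity).

Definition is_iso (C : category) (X Y : C) (f : mor X Y) :=
  exists g : mor Y X, g \oc f = idm X /\ f \oc g = idm Y.

Definition is_isomorphic (C : category) (X Y : C) :=
  exists f : mor X Y, is_iso f.

(* Sections are not required to have a cokernel: in a category which is not
   weakly idempotent complete, a direct summand need not have a complement. *)
Definition direct_summand (C : category) (X Y : C) :=
  exists (s : mor X Y) (r : mor Y X), r \oc s = idm X.

Definition is_initial (C : category) (Z : C) :=
  forall X : C, exists f : mor Z X, forall g : mor Z X, g = f.

Definition is_terminal (C : category) (Z : C) :=
  forall X : C, exists f : mor X Z, forall g : mor X Z, g = f.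

Definition is_coproduct (C : category) (I : Type) (X : I -> C) (Y : C)
    (e : forall i, mor (X i) Y) :=
  forall (Z : C) (f : forall i, mor (X i) Z),
    exists! g : mor Y Z, forall i, g \oc e i = f i.

Definition is_pushout (C : category) (X Y Z W : C)
    (f : mor X Y) (g : mor X Z) (g' : mor Y W) (f' : mor Z W) :=
  g' \oc f = f' \oc g /\
  forall (T : C) (u : mor Y T) (v : mor Z T), u \oc f = v \oc g ->
    exists! h : mor W T, h \oc g' = u /\ h \oc f' = v.

Definition is_pullback (C : category) (X Y Z W : C)
    (g' : mor W Y) (f' : mor W Z) (f : mor Y X) (g : mor Z X) :=
  f \oc g' = g \oc f' /\
  forall (T : C) (u : mor T Y) (v : mor T Z), f \oc u = g \oc v ->
    exists! h : mor T W, g' \oc h = u /\ f' \oc h = v.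

Record functor (C D : category) := Functor {
  fobj :> C -> D;
  fmap : forall X Y : C, mor X Y -> mor (fobj X) (fobj Y);
  fmap1 : forall X, fmap (idm X) = idm (fobj X);
  fmapM : forall X Y Z (g : mor Y Z) (f : mor X Y),
    fmap (g \oc f) = fmap g \oc fmap f }.

Arguments fmap {C D} _ {X Y} _.

Section ComposeFunctors.
Variables (C D E : category) (G : functor D E) (F : functor C D).

Let cmap (X Y : C) (f : mor X Y) : mor (G (F X)) (G (F Y)) := fmap G (fmap F f).

Lemma fcomp1 X : cmap (idm X) = idm (G (F X)).
Proof. by rewrite /cmap !fmap1. Qed.

Lemma fcompM X Y Z (g : mor Y Z) (f : mor X Y) :
  cmap (g \oc f) = cmap g \oc cmap f.
Proof. by rewrite /cmap !fmapM. Qed.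

Definition fcomp : functor C E := Functor fcomp1 fcompM.

End ComposeFunctors.

Section FunctorId.
Variable C : category.

Definition fid : functor C C :=
  @Functor C C id (fun X Y f => f) (fun X => erefl) (fun X Y Z g f => erefl).

End FunctorId.

Definition natural (C D : category) (F G : functor C D)
    (a : forall X, mor (F X) (G X)) :=
  forall (X Y : C) (f : mor X Y), a Y \oc fmap F f = fmap G f \oc a X.

Definition naturally_isomorphic (C D : category) (F G : functor C D) :=
  exists a : forall X, mor (F X) (G X), natural a /\ forall X, is_iso (a X).

Definition is_equivalence (C D : category) (F : functor C D) :=
  (forall (X Y : C) (g : mor (F X) (F Y)), exists! f : mor X Y, fmap F f = g) /\
  (forall Y : D, exists X : C, is_isomorphic (F X) Y).

Record adjunction (C D : category) (L : functor D C) (R : functor C D) :=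
  Adjunction {
    adj_unit : forall N : D, mor N (R (L N));
    adj_counit : forall M : C, mor (L (R M)) M;
    unit_nat : @natural D D (fid D) (fcomp R L) adj_unit;
    counit_nat : @natural C C (fcomp L R) (fid C) adj_counit;
    adj_triL : forall N, adj_counit (L N) \oc fmap L (adj_unit N) = idm (L N);
    adj_triR : forall M, fmap R (adj_counit M) \oc adj_unit (R M) = idm (R M) }.

Arguments adj_counit {C D L R} a M.
Arguments adj_unit {C D L R} a N.

Definition mor_class (C : category) := forall X Y : C, mor X Y -> Prop.

(* The universal property of [C -> C[W^-1]] up to natural isomorphism:
   precomposition with [Q] is, for every category [X], an equivalence from
   functors [E -> X] to functors [C -> X] inverting [W]. *)
Definition is_localization (C E : category) (W : mor_class C)
    (Q : functor C E) :=
  [/\ forall (X Y : C) (f : mor X Y), W X Y f -> is_iso (fmap Q f),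
      forall (X : category) (F : functor C X),
        (forall (A B : C) (f : mor A B), W A B f -> is_iso (fmap F f)) ->
        exists G : functor E X, naturally_isomorphic (fcomp G Q) F
    & forall (X : category) (G H : functor E X)
        (a : forall A : C, mor (G (Q A)) (H (Q A))),
        @natural C X (fcomp G Q) (fcomp H Q) a ->
        exists b : forall A : E, mor (G A) (H A),
          [/\ natural b, forall A : C, b (Q A) = a A
            & forall b' : forall A : E, mor (G A) (H A), natural b' ->
                (forall A : C, b' (Q A) = a A) -> forall A, b' A = b A]].

Definition retract_mor (C : category) (X Y X' Y' : C)
    (f : mor X Y) (g : mor X' Y') :=
  exists (s : mor X X') (r : mor X' X) (s' : mor Y Y') (r' : mor Y' Y),
    [/\ r \oc s = idm X, r' \oc s' = idm Y,
        s' \oc f = g \oc s & f \oc r = r' \oc g].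

Definition retracts_of (C : category) (K : mor_class C) : mor_class C :=
  fun X Y f => exists (X' Y' : C) (g : mor X' Y'), K X' Y' g /\ retract_mor f g.

Definition has_lift (C : category) (A B X Y : C)
    (i : mor A B) (p : mor X Y) :=
  forall (u : mor A X) (v : mor B Y), p \oc u = v \oc i ->
    exists h : mor B X, h \oc i = u /\ p \oc h = v.

Record model_structure (C : category) := ModelStructure {
  weq : mor_class C;
  cof : mor_class C;
  fib : mor_class C;
  weq_comp : forall (X Y Z : C) (f : mor X Y) (g : mor Y Z),
    weq f -> weq g -> weq (g \oc f);
  weq_cancel_l : forall (X Y Z : C) (f : mor X Y) (g : mor Y Z),
    weq g -> weq (g \oc f) -> weq f;
  weq_cancel_r : forall (X Y Z : C) (f : mor X Y) (g : mor Y Z),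
    weq f -> weq (g \oc f) -> weq g;
  weq_retract : forall (X Y : C) (f : mor X Y), retracts_of weq f -> weq f;
  cof_retract : forall (X Y : C) (f : mor X Y), retracts_of cof f -> cof f;
  fib_retract : forall (X Y : C) (f : mor X Y), retracts_of fib f -> fib f;
  tcof_fib_lift : forall (A B X Y : C) (i : mor A B) (p : mor X Y),
    cof i -> weq i -> fib p -> has_lift i p;
  cof_tfib_lift : forall (A B X Y : C) (i : mor A B) (p : mor X Y),
    cof i -> fib p -> weq p -> has_lift i p;
  cof_tfib_factor : forall (X Y : C) (f : mor X Y),
    exists (Z : C) (i : mor X Z) (p : mor Z Y),
      [/\ p \oc i = f, cof i, fib p & weq p];
  tcof_fib_factor : forall (X Y : C) (f : mor X Y),
    exists (Z : C) (i : mor X Z) (p : mor Z Y),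
      [/\ p \oc i = f, cof i, weq i & fib p] }.

Arguments weq {C} m {X Y} _.
Arguments cof {C} m {X Y} _.
Arguments fib {C} m {X Y} _.

Definition cofibrant (C : category) (M : model_structure C) (X : C) :=
  exists (Z : C) (f : mor Z X), is_initial Z /\ cof M f.

Definition fibrant (C : category) (M : model_structure C) (X : C) :=
  exists (Z : C) (f : mor X Z), is_terminal Z /\ fib M f.

Record lincat (k : comPzRingType) := LinCat {
  lobj : Type;
  lhom : lobj -> lobj -> lmodType k;
  lidm : forall X, lhom X X;
  lcomp : forall X Y Z, lhom Y Z -> lhom X Y -> lhom X Z;
  lcompA : forall X Y Z T (h : lhom Z T) (g : lhom Y Z) (f : lhom X Y),
    lcomp h (lcomp g f) = lcomp (lcomp h g) f;
  lcomp1m : forall X Y (f : lhom X Y), lcomp (lidm Y) f = f;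
  lcompm1 : forall X Y (f : lhom X Y), lcomp f (lidm X) = f;
  lcompPl : forall X Y Z (a : k) (g g' : lhom Y Z) (f : lhom X Y),
    lcomp (a *: g + g') f = a *: lcomp g f + lcomp g' f;
  lcompPr : forall X Y Z (a : k) (g : lhom Y Z) (f f' : lhom X Y),
    lcomp g (a *: f + f') = a *: lcomp g f + lcomp g f' }.

Coercion cat_of_lincat (k : comPzRingType) (A : lincat k) : category :=
  Category (@lcompA k A) (@lcomp1m k A) (@lcompm1 k A).

HB.instance Definition _ (k : comPzRingType) (A : lincat k) (X Y : A) :=
  GRing.Lmodule.copy (mor X Y) (lhom X Y).


Section CompLinear.
Variables (k : comPzRingType) (A : lincat k).
Implicit Types X Y Z : A.

Lemma mcompPl X Y Z (a : k) (g g' : mor Y Z) (f : mor X Y) :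
  (a *: g + g') \oc f = a *: (g \oc f) + g' \oc f.
Proof. exact: lcompPl. Qed.

Lemma mcompPr X Y Z (a : k) (g : mor Y Z) (f f' : mor X Y) :
  g \oc (a *: f + f') = a *: (g \oc f) + g \oc f'.
Proof. exact: lcompPr. Qed.

Lemma mcompDl X Y Z (g g' : mor Y Z) (f : mor X Y) :
  (g + g') \oc f = g \oc f + g' \oc f.
Proof. by rewrite -[g]scale1r mcompPl !scale1r. Qed.

Lemma mcompDr X Y Z (g : mor Y Z) (f f' : mor X Y) :
  g \oc (f + f') = g \oc f + g \oc f'.
Proof. by rewrite -[f]scale1r mcompPr !scale1r. Qed.

Lemma mcomp0m X Y Z (f : mor X Y) : (0 : mor Y Z) \oc f = 0.
Proof. by apply: (addrI ((0 : mor Y Z) \oc f)); rewrite -mcompDl !addr0. Qed.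

Lemma mcompm0 X Y Z (g : mor Y Z) : g \oc (0 : mor X Y) = 0.
Proof. by apply: (addrI (g \oc (0 : mor X Y))); rewrite -mcompDr !addr0. Qed.

Lemma mcompBl X Y Z (g g' : mor Y Z) (f : mor X Y) :
  (g - g') \oc f = g \oc f - g' \oc f.
Proof. by apply/eqP; rewrite eq_sym subr_eq -mcompDl subrK. Qed.

Lemma mcompBr X Y Z (g : mor Y Z) (f f' : mor X Y) :
  g \oc (f - f') = g \oc f - g \oc f'.
Proof. by apply/eqP; rewrite eq_sym subr_eq -mcompDr subrK. Qed.

End CompLinear.

Definition additive_functor (k : comPzRingType) (A B : lincat k)
    (F : functor A B) :=
  forall (X Y : A) (f g : mor X Y), fmap F (f + g) = fmap F f + fmap F g.

Definition klinear_functor (k : comPzRingType) (A B : lincat k)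
    (F : functor A B) :=
  forall (X Y : A) (a : k) (f g : mor X Y),
    fmap F (a *: f + g) = a *: fmap F f + fmap F g.

Section ExactNotions.
Variables (k : comPzRingType) (A : lincat k).

Definition is_kernel (X Y Z : A) (i : mor X Y) (p : mor Y Z) :=
  p \oc i = 0 /\
  forall (T : A) (f : mor T Y), p \oc f = 0 -> exists! g : mor T X, i \oc g = f.

Definition is_cokernel (X Y Z : A) (p : mor Y Z) (i : mor X Y) :=
  p \oc i = 0 /\
  forall (T : A) (f : mor Y T), f \oc i = 0 -> exists! g : mor Z T, g \oc p = f.

Definition pair_class := forall X Y Z : A, mor X Y -> mor Y Z -> Prop.

Definition inflation_for (E : pair_class) (X Y : A) (i : mor X Y) :=
  exists (Z : A) (p : mor Y Z), E X Y Z i p.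

Definition deflation_for (E : pair_class) (Y Z : A) (p : mor Y Z) :=
  exists (X : A) (i : mor X Y), E X Y Z i p.

End ExactNotions.

(* Quillen's axioms, in the form given by Buehler. *)
Record exact_cat (k : comPzRingType) := ExactCat {
  ex_lincat :> lincat k;
  zob : ex_lincat;
  zobP : idm zob = 0;
  biproduct : forall X Y : ex_lincat,
    exists (Z : ex_lincat) (i1 : mor X Z) (i2 : mor Y Z)
           (p1 : mor Z X) (p2 : mor Z Y),
      [/\ p1 \oc i1 = idm X, p2 \oc i2 = idm Y, p1 \oc i2 = 0, p2 \oc i1 = 0
        & i1 \oc p1 + i2 \oc p2 = idm Z];
  conflation : pair_class ex_lincat;
  conflation_ker : forall X Y Z (i : mor X Y) (p : mor Y Z),
    conflation i p -> is_kernel i p;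
  conflation_coker : forall X Y Z (i : mor X Y) (p : mor Y Z),
    conflation i p -> is_cokernel p i;
  conflation_isom : forall X Y Z X' Y' Z' (i : mor X Y) (p : mor Y Z)
      (i' : mor X' Y') (p' : mor Y' Z')
      (a : mor X X') (b : mor Y Y') (c : mor Z Z'),
    is_iso a -> is_iso b -> is_iso c -> b \oc i = i' \oc a -> c \oc p = p' \oc b ->
    conflation i p -> conflation i' p';
  inflation_idm : forall X : ex_lincat, inflation_for conflation (idm X);
  deflation_idm : forall X : ex_lincat, deflation_for conflation (idm X);
  inflation_comp : forall X Y Z (i : mor X Y) (j : mor Y Z),
    inflation_for conflation i -> inflation_for conflation j ->
    inflation_for conflation (j \oc i);
  deflation_comp : forall X Y Z (p : mor X Y) (q : mor Y Z),
    deflation_for conflation p -> deflation_for conflation q ->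
    deflation_for conflation (q \oc p);
  inflation_pushout : forall X Y X' (i : mor X Y) (f : mor X X'),
    inflation_for conflation i ->
    exists (Y' : ex_lincat) (f' : mor Y Y') (i' : mor X' Y'),
      is_pushout i f f' i' /\ inflation_for conflation i';
  deflation_pullback : forall Y Z Z' (p : mor Y Z) (f : mor Z' Z),
    deflation_for conflation p ->
    exists (Y' : ex_lincat) (f' : mor Y' Y) (p' : mor Y' Z'),
      is_pullback f' p' p f /\ deflation_for conflation p' }.

Arguments zob {k} e.
Arguments conflation {k e X Y Z} _ _.

Section Exact.
Variables (k : comPzRingType) (C : exact_cat k).

Definition inflation (X Y : C) (i : mor X Y) := inflation_for (@conflation k C) i.

Definition deflation (Y Z : C) (p : mor Y Z) := deflation_for (@conflation k C) p.

Definition injective_obj (J : C) :=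
  forall (X Y : C) (i : mor X Y) (f : mor X J), inflation i ->
    exists g : mor Y J, g \oc i = f.

Definition projective_obj (P : C) :=
  forall (Y Z : C) (p : mor Y Z) (f : mor P Z), deflation p ->
    exists g : mor P Y, p \oc g = f.

End Exact.

Definition exact_functor (k : comPzRingType) (C D : exact_cat k)
    (F : functor C D) :=
  additive_functor F /\
  forall (X Y Z : C) (i : mor X Y) (p : mor Y Z),
    conflation i p -> conflation (fmap F i) (fmap F p).

Record frobenius_cat (k : comPzRingType) := FrobeniusCat {
  fr_exact :> exact_cat k;
  enough_injectives : forall X : fr_exact,
    exists (J : fr_exact) (i : mor X J), injective_obj J /\ inflation i;
  enough_projectives : forall X : fr_exact,
    exists (P : fr_exact) (p : mor P X), projective_obj P /\ deflation p;
  injective_projective : forall X : fr_exact,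
    injective_obj X <-> projective_obj X }.

Record submodule (k : comPzRingType) (V : lmodType k) := Submodule {
  smem :> V -> Prop;
  smem0 : smem 0;
  smemP : forall (a : k) (u v : V), smem u -> smem v -> smem (a *: u + v) }.

Module QuotMod.
Section QuotMod.
Variables (k : comPzRingType) (V : lmodType k) (U : submodule V).

Lemma smemD u v : U u -> U v -> U (u + v).
Proof. by move=> Uu Uv; rewrite -[u]scale1r; apply: smemP. Qed.

Lemma smemZ a u : U u -> U (a *: u).
Proof. by move=> Uu; rewrite -[_ *: _]addr0; apply: smemP => //; apply: smem0. Qed.

Lemma smemN u : U u -> U (- u).
Proof. by move=> Uu; rewrite -scaleN1r; apply: smemZ. Qed.

Definition rel_sub (u v : V) : bool := `[< U (u - v) >].

Lemma rel_sub_refl : reflexive rel_sub.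
Proof. by move=> u; apply/asboolP; rewrite subrr; apply: smem0. Qed.

Lemma rel_sub_sym : symmetric rel_sub.
Proof.
by move=> u v; apply/asboolP/asboolP => /smemN; rewrite opprB.
Qed.

Lemma rel_sub_trans : transitive rel_sub.
Proof.
move=> v u w /asboolP Uuv /asboolP Uvw; apply/asboolP.
by have := smemD Uuv Uvw; rewrite addrA subrK.
Qed.

Canonical rel_sub_equiv :=
  EquivRel rel_sub rel_sub_refl rel_sub_sym rel_sub_trans.

Definition quotmod := {eq_quot rel_sub}.

HB.instance Definition _ : EqQuotient V rel_sub quotmod :=
  EqQuotient.on quotmod.
HB.instance Definition _ := Choice.on quotmod.

Definition proj (u : V) : quotmod := \pi_quotmod u.

Lemma projP u v : proj u = proj v <-> U (u - v).
Proof.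
split=> [/eqP|Uuv]; first by rewrite eqmodE => /asboolP.
by apply/eqP; rewrite eqmodE; apply/asboolP.
Qed.

Lemma proj_repr (x : quotmod) : proj (repr x) = x.
Proof. exact: reprK. Qed.

Lemma repr_proj u : U (repr (proj u) - u).
Proof. by apply/projP; rewrite proj_repr. Qed.

Definition zero : quotmod := proj 0.
Definition opp (x : quotmod) : quotmod := proj (- repr x).
Definition add (x y : quotmod) : quotmod := proj (repr x + repr y).
Definition scale (a : k) (x : quotmod) : quotmod := proj (a *: repr x).

Lemma oppE u : opp (proj u) = proj (- u).
Proof.
by apply/projP; rewrite -opprD; apply: smemN; apply: repr_proj.
Qed.

Lemma addE u v : add (proj u) (proj v) = proj (u + v).
Proof. by apply/projP; rewrite opprD addrACA; apply: smemD; apply: repr_proj. Qed.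

Lemma scaleE a u : scale a (proj u) = proj (a *: u).
Proof. by apply/projP; rewrite -scalerBr; apply: smemZ; apply: repr_proj. Qed.

Lemma addqA : associative add.
Proof.
by move=> x y z; rewrite -(proj_repr x) -(proj_repr y) -(proj_repr z) !addE addrA.
Qed.

Lemma addqC : commutative add.
Proof. by move=> x y; rewrite -(proj_repr x) -(proj_repr y) !addE addrC. Qed.

Lemma add0q : left_id zero add.
Proof. by move=> x; rewrite -(proj_repr x) addE add0r. Qed.

Lemma addNq : left_inverse zero opp add.
Proof. by move=> x; rewrite -(proj_repr x) oppE addE addNr. Qed.

HB.instance Definition _ := GRing.isZmodule.Build quotmod addqA addqC add0q addNq.

Lemma scaleqA a b x : scale a (scale b x) = scale (a * b) x.
Proof. by rewrite -(proj_repr x) !scaleE scalerA. Qed.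

Lemma scale1q : left_id 1 scale.
Proof. by move=> x; rewrite -(proj_repr x) scaleE scale1r. Qed.

Lemma scaleqDr a x y : scale a (add x y) = add (scale a x) (scale a y).
Proof.
by rewrite -(proj_repr x) -(proj_repr y) addE !scaleE addE scalerDr.
Qed.

Lemma scaleqDl x a b : scale (a + b) x = add (scale a x) (scale b x).
Proof. by rewrite -(proj_repr x) !scaleE addE scalerDl. Qed.

HB.instance Definition _ :=
  GRing.Zmodule_isLmodule.Build k quotmod scaleqA scale1q scaleqDr scaleqDl.

Definition quotient_module : lmodType k := quotmod.

Lemma projL a u v : (proj (a *: u + v) : quotient_module) = a *: proj u + proj v.
Proof. by rewrite -addE -scaleE. Qed.

End QuotMod.
End QuotMod.

Section StableCategory.
Variables (k : comPzRingType) (C : frobenius_cat k).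

Definition stably_null (X Y : C) (f : mor X Y) :=
  exists (J : C) (u : mor X J) (v : mor J Y), injective_obj J /\ f = v \oc u.

Lemma stably_null_compl (X Y Z : C) (g : mor Y Z) (f : mor X Y) :
  stably_null f -> stably_null (g \oc f).
Proof.
by move=> [J [u [v [Jinj ->]]]]; exists J, u, (g \oc v); rewrite mcompA.
Qed.

Lemma stably_null_compr (X Y Z : C) (g : mor Y Z) (f : mor X Y) :
  stably_null g -> stably_null (g \oc f).
Proof.
by move=> [J [u [v [Jinj ->]]]]; exists J, (u \oc f), v; rewrite mcompA.
Qed.

Lemma stably_null0 (X Y : C) : stably_null (0 : mor X Y).
Proof.
have [J [i [Jinj _]]] := enough_injectives X.
by exists J, i, 0; rewrite mcomp0m.
Qed.

Lemma stably_nullP (X Y : C) (a : k) (f g : mor X Y) :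
  stably_null f -> stably_null g -> stably_null (a *: f + g).
Proof.
move=> [J [u [v [Jinj ->]]]] [J' [u' [v' [Jinj' ->]]]].
have [K [i1 [i2 [p1 [p2 [p1i1 p2i2 p1i2 p2i1 ip]]]]]] := biproduct J J'.
exists K, (i1 \oc u + i2 \oc u'), (a *: (v \oc p1) + v' \oc p2); split.
  move=> A B j f0 jinf.
  have [h1 h1E] := Jinj A B j (p1 \oc f0) jinf.
  have [h2 h2E] := Jinj' A B j (p2 \oc f0) jinf.
  exists (i1 \oc h1 + i2 \oc h2).
  by rewrite mcompDl -!mcompA h1E h2E !mcompA -mcompDl ip mcomp1m.
rewrite mcompPl !mcompDr -!mcompA !(mcompA p1) !(mcompA p2).
by rewrite p1i1 p2i2 p1i2 p2i1 !mcomp1m !mcomp0m !mcompm0 addr0 add0r.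
Qed.

Definition null_submodule (X Y : C) : submodule (mor X Y) :=
  Submodule (stably_null0 X Y) (@stably_nullP X Y).

Definition stab_hom (X Y : C) : lmodType k :=
  QuotMod.quotient_module (null_submodule X Y).

Definition stab_proj (X Y : C) (f : mor X Y) : stab_hom X Y :=
  QuotMod.proj (null_submodule X Y) f.

Definition stab_rep (X Y : C) (f : stab_hom X Y) : mor X Y :=
  @repr (mor X Y) (QuotMod.quotmod (null_submodule X Y)) f.

Lemma stab_projP (X Y : C) (f g : mor X Y) :
  stab_proj f = stab_proj g <-> stably_null (f - g).
Proof. exact: QuotMod.projP. Qed.

Lemma stab_repK (X Y : C) (f : stab_hom X Y) : stab_proj (stab_rep f) = f.
Proof. exact: QuotMod.proj_repr. Qed.

Lemma stab_projL (X Y : C) (a : k) (f g : mor X Y) :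
  stab_proj (a *: f + g) = a *: stab_proj f + stab_proj g.
Proof. exact: QuotMod.projL. Qed.

Definition stab_idm (X : C) : stab_hom X X := stab_proj (idm X).

Definition stab_comp (X Y Z : C) (g : stab_hom Y Z) (f : stab_hom X Y) :
  stab_hom X Z := stab_proj (stab_rep g \oc stab_rep f).

Lemma stab_compE (X Y Z : C) (g : mor Y Z) (f : mor X Y) :
  stab_comp (stab_proj g) (stab_proj f) = stab_proj (g \oc f).
Proof.
apply/stab_projP.
set g' := stab_rep _; set f' := stab_rep _.
have -> : g' \oc f' - g \oc f = 1 *: (g' \oc (f' - f)) + (g' - g) \oc f.
  by rewrite scale1r mcompBr mcompBl addrA subrK.
apply: stably_nullP.
  by apply: stably_null_compl; apply/stab_projP; rewrite stab_repK.
by apply: stably_null_compr; apply/stab_projP; rewrite stab_repK.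
Qed.

Lemma stab_compA (X Y Z T : C)
    (h : stab_hom Z T) (g : stab_hom Y Z) (f : stab_hom X Y) :
  stab_comp h (stab_comp g f) = stab_comp (stab_comp h g) f.
Proof.
by rewrite -(stab_repK h) -(stab_repK g) -(stab_repK f) !stab_compE mcompA.
Qed.

Lemma stab_comp1m (X Y : C) (f : stab_hom X Y) : stab_comp (stab_idm Y) f = f.
Proof. by rewrite -(stab_repK f) stab_compE mcomp1m. Qed.

Lemma stab_compm1 (X Y : C) (f : stab_hom X Y) : stab_comp f (stab_idm X) = f.
Proof. by rewrite -(stab_repK f) stab_compE mcompm1. Qed.

Lemma stab_compPl (X Y Z : C) (a : k) (g g' : stab_hom Y Z) (f : stab_hom X Y) :
  stab_comp (a *: g + g') f = a *: stab_comp g f + stab_comp g' f.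
Proof.
rewrite -(stab_repK g) -(stab_repK g') -(stab_repK f).
by rewrite -stab_projL !stab_compE mcompPl stab_projL.
Qed.

Lemma stab_compPr (X Y Z : C) (a : k) (g : stab_hom Y Z) (f f' : stab_hom X Y) :
  stab_comp g (a *: f + f') = a *: stab_comp g f + stab_comp g f'.
Proof.
rewrite -(stab_repK g) -(stab_repK f') -(stab_repK f).
by rewrite -stab_projL !stab_compE mcompPr stab_projL.
Qed.

Definition stab : lincat k :=
  LinCat stab_compA stab_comp1m stab_compm1 stab_compPl stab_compPr.

Lemma stab_functorM (X Y Z : C) (g : mor Y Z) (f : mor X Y) :
  stab_proj (g \oc f) = stab_comp (stab_proj g) (stab_proj f).
Proof. by rewrite stab_compE. Qed.

Definition stab_functor : functor C stab :=
  @Functor C stab (fun X => X) stab_proj (fun X => erefl) stab_functorM.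

Definition stable_iso (X Y : C) (f : mor X Y) := is_iso (fmap stab_functor f).

End StableCategory.

Record injective_choice (k : comPzRingType) (C : frobenius_cat k) :=
  InjectiveChoice {
    inj_hull : C -> C;
    susp : C -> C;
    hull_map : forall X, mor X (inj_hull X);
    susp_map : forall X, mor (inj_hull X) (susp X);
    hull_conflation : forall X, conflation (hull_map X) (susp_map X);
    hull_injective : forall X, injective_obj (inj_hull X) }.

Record projective_choice (k : comPzRingType) (C : frobenius_cat k) :=
  ProjectiveChoice {
    proj_cover : C -> C;
    desusp : C -> C;
    desusp_map : forall X, mor (desusp X) (proj_cover X);
    cover_map : forall X, mor (proj_cover X) X;
    cover_conflation : forall X, conflation (desusp_map X) (cover_map X);
    cover_projective : forall X, projective_obj (proj_cover X) }.

Definition triangle_isom (A : category) (S : functor A A)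
    (X Y Z X' Y' Z' : A)
    (u : mor X Y) (v : mor Y Z) (w : mor Z (S X))
    (u' : mor X' Y') (v' : mor Y' Z') (w' : mor Z' (S X')) :=
  exists (a : mor X X') (b : mor Y Y') (c : mor Z Z'),
    [/\ is_iso a, is_iso b & is_iso c] /\
    [/\ b \oc u = u' \oc a, c \oc v = v' \oc b
      & fmap S a \oc w = w' \oc c].

(* The data of a triangulated category.  The axioms TR1-TR4 are not part of
   the record: the notions below only involve the data, and the stable category
   of a Frobenius category satisfies the axioms by Happel's theorem. *)
Record tricat (k : comPzRingType) := TriCat {
  tri_lincat :> lincat k;
  tri_shift : functor tri_lincat tri_lincat;
  triangle : forall X Y Z : tri_lincat,
    mor X Y -> mor Y Z -> mor Z (tri_shift X) -> Prop }.

Arguments tri_shift {k} t.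
Arguments triangle {k t X Y Z} _ _ _.

Record tri_functor (k : comPzRingType) (A B : tricat k) := TriFunctor {
  tri_fun :> functor A B;
  tri_fun_linear : klinear_functor tri_fun;
  tri_comm : forall X : A, mor (tri_fun (tri_shift A X)) (tri_shift B (tri_fun X));
  tri_comm_natural :
    @natural A B (fcomp tri_fun (tri_shift A)) (fcomp (tri_shift B) tri_fun) tri_comm;
  tri_comm_isom : forall X : A, is_iso (tri_comm X);
  tri_fun_triangle : forall (X Y Z : A)
      (u : mor X Y) (v : mor Y Z) (w : mor Z (tri_shift A X)),
    triangle u v w ->
    triangle (fmap tri_fun u) (fmap tri_fun v) (tri_comm X \oc fmap tri_fun w) }.

Arguments tri_comm {k A B} t X.

Definition triangle_equivalent (k : comPzRingType) (A B : tricat k) :=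
  exists F : tri_functor A B, is_equivalence F.

(* Full triangulated subcategories are taken closed under isomorphism. *)
Record triangulated_subcat (k : comPzRingType) (A : tricat k) (P : A -> Prop) :
    Prop := TriangulatedSubcat {
  tsub_zero : forall X : A, idm X = 0 -> P X;
  tsub_isom : forall X Y : A, is_isomorphic X Y -> P X -> P Y;
  tsub_shift : forall X : A, P X <-> P (tri_shift A X);
  tsub_cone : forall (X Y Z : A)
      (u : mor X Y) (v : mor Y Z) (w : mor Z (tri_shift A X)),
    triangle u v w -> [/\ P X -> P Y -> P Z, P Y -> P Z -> P X & P X -> P Z -> P Y] }.

Definition coproduct_closed (A : category) (P : A -> Prop) :=
  forall (I : Type) (X : I -> A) (Y : A) (e : forall i, mor (X i) Y),
    is_coproduct e -> (forall i, P (X i)) -> P Y.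

Definition Tria (k : comPzRingType) (A : tricat k) (G : A -> Prop) (X : A) :=
  forall P : A -> Prop, triangulated_subcat P -> coproduct_closed P ->
    (forall Y, G Y -> P Y) -> P X.

Lemma Tria_shift (k : comPzRingType) (A : tricat k) (G : A -> Prop) (X : A) :
  Tria G X -> Tria G (tri_shift A X).
Proof.
move=> TX P tP cP GP; have [+ _] := tsub_shift tP X.
by apply; apply: TX.
Qed.

Section FullSubcategory.
Variables (k : comPzRingType) (A : tricat k) (P : A -> Prop).
Hypothesis P_shift : forall X : A, P X -> P (tri_shift A X).

Definition full_lincat : lincat k :=
  @LinCat k {X : A | P X} (fun X Y => mor (sval X) (sval Y))
    (fun X => idm (sval X)) (fun X Y Z g f => g \oc f)
    (fun X Y Z T h g f => mcompA h g f)
    (fun X Y f => mcomp1m f) (fun X Y f => mcompm1 f)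
    (fun X Y Z a g g' f => mcompPl a g g' f)
    (fun X Y Z a g f f' => mcompPr a g f f').

Definition full_shift : functor full_lincat full_lincat :=
  @Functor full_lincat full_lincat
    (fun X => exist P (tri_shift A (sval X)) (P_shift (svalP X)))
    (fun X Y f => fmap (tri_shift A) f)
    (fun X => fmap1 (tri_shift A) (sval X))
    (fun X Y Z g f => fmapM (tri_shift A) g f).

Definition full_tricat : tricat k :=
  @TriCat k full_lincat full_shift
    (fun X Y Z u v w => @triangle k A (sval X) (sval Y) (sval Z) u v w).

End FullSubcategory.

Definition Tria_cat (k : comPzRingType) (A : tricat k) (G : A -> Prop) :
  tricat k := full_tricat (@Tria_shift k A G).

(* [Q : A -> T] is a Verdier quotient of [A] by its full subcategory [P]: it is
   the localization at the morphisms with cone in [P], and the triangles of [T]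
   are those is_isomorphic to images of triangles of [A]. *)
Definition is_triangle_quotient (k : comPzRingType) (A : tricat k)
    (P : A -> Prop) (T : tricat k) (Q : tri_functor A T) :=
  @is_localization A T
    (fun X Y f => exists (Z : A) (v : mor Y Z) (w : mor Z (tri_shift A X)),
       triangle f v w /\ P Z) Q /\
  forall (X Y Z : T) (u : mor X Y) (v : mor Y Z) (w : mor Z (tri_shift T X)),
    triangle u v w ->
    exists (X' Y' Z' : A)
        (u' : mor X' Y') (v' : mor Y' Z') (w' : mor Z' (tri_shift A X')),
      triangle u' v' w' /\
      triangle_isom (fmap Q u') (fmap Q v') (tri_comm Q X' \oc fmap Q w') u v w.

Section StableTriangles.
Variables (k : comPzRingType) (C : frobenius_cat k) (IC : injective_choice C).

Let I := inj_hull IC.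
Let S := susp IC.

Definition susp_rel (X Y : C) (f : mor X Y) (h : mor (S X) (S Y)) :=
  exists g : mor (I X) (I Y),
    g \oc hull_map IC X = hull_map IC Y \oc f /\
    h \oc susp_map IC X = susp_map IC Y \oc g.

Lemma hull_inflation (X : C) : inflation (hull_map IC X).
Proof. by exists (S X), (susp_map IC X); apply: hull_conflation. Qed.

Lemma hull_comp0 (X : C) : susp_map IC X \oc hull_map IC X = 0.
Proof. by have [] := conflation_ker (hull_conflation IC X). Qed.

Lemma susp_factor (X Y : C) (f : mor (I X) Y) :
  f \oc hull_map IC X = 0 -> exists h : mor (S X) Y, h \oc susp_map IC X = f.
Proof.
have [_ coker] := conflation_coker (hull_conflation IC X).
by move=> /coker [h [hE _]]; exists h.
Qed.

Lemma susp_epi (X Y : C) (h h' : mor (S X) Y) :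
  h \oc susp_map IC X = h' \oc susp_map IC X -> h = h'.
Proof.
have [_ coker] := conflation_coker (hull_conflation IC X).
have /coker [c [_ cP]] : (h \oc susp_map IC X) \oc hull_map IC X = 0.
  by rewrite -mcompA hull_comp0 mcompm0.
by move=> hh'; rewrite -(cP h) // -(cP h').
Qed.

Lemma susp_ex (X Y : C) (f : mor X Y) : exists h, susp_rel f h.
Proof.
have [g gE] :=
  @hull_injective k C IC Y _ _ _ (hull_map IC Y \oc f) (hull_inflation X).
have [|h hE] := @susp_factor X _ (susp_map IC Y \oc g).
  by rewrite -mcompA gE mcompA hull_comp0 mcomp0m.
by exists h, g.
Qed.

Lemma susp_relP (X Y : C) (a : k) (f f' : mor X Y) h h' :
  susp_rel f h -> susp_rel f' h' -> susp_rel (a *: f + f') (a *: h + h').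
Proof.
move=> [g [gE hE]] [g' [g'E h'E]]; exists (a *: g + g').
by rewrite !mcompPl !mcompPr gE hE g'E h'E.
Qed.

Lemma susp_rel_null (X Y : C) (f : mor X Y) h :
  susp_rel f h -> stably_null f -> stably_null h.
Proof.
move=> [g [gE hE]] [J [u [v [Jinj fE]]]].
have [u' u'E] := Jinj _ _ _ u (hull_inflation X).
have [|c cE] := @susp_factor X _ (g - hull_map IC Y \oc (v \oc u')).
  by rewrite mcompBl gE fE -!mcompA u'E subrr.
exists (I Y), c, (susp_map IC Y); split; first exact: hull_injective.
apply: susp_epi; rewrite hE -mcompA cE mcompBr (mcompA (susp_map IC Y)) hull_comp0.
by rewrite mcomp0m subr0.
Qed.

Lemma susp_rel_stable (X Y : C) (f f' : mor X Y) h h' :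
  susp_rel f h -> susp_rel f' h' ->
  stab_proj f = stab_proj f' -> stab_proj h = stab_proj h'.
Proof.
move=> fh fh' /stab_projP ff'; apply/stab_projP.
have := susp_relP (-1) fh' fh; rewrite !scaleN1r ![- _ + _]addrC => rel.
exact: susp_rel_null rel ff'.
Qed.

Definition stab_susp_mor (X Y : C) (f : stab_hom X Y) : stab_hom (S X) (S Y) :=
  stab_proj (sval (cid (susp_ex (stab_rep f)))).

Lemma stab_susp_morE (X Y : C) (f : mor X Y) h :
  susp_rel f h -> stab_susp_mor (stab_proj f) = stab_proj h.
Proof.
move=> fh; rewrite /stab_susp_mor; case: cid => h' /= fh'.
by apply: susp_rel_stable fh' fh _; rewrite stab_repK.
Qed.

Lemma stab_susp1 (X : C) : stab_susp_mor (stab_idm X) = stab_idm (S X).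
Proof.
by apply: stab_susp_morE; exists (idm (I X)); rewrite !mcomp1m !mcompm1.
Qed.

Lemma stab_suspM (X Y Z : C) (g : stab_hom Y Z) (f : stab_hom X Y) :
  stab_susp_mor (stab_comp g f) =
  stab_comp (stab_susp_mor g) (stab_susp_mor f).
Proof.
rewrite -(stab_repK g) -(stab_repK f) stab_compE.
have [h' gh'] := susp_ex (stab_rep g); have [h fh] := susp_ex (stab_rep f).
rewrite (stab_susp_morE gh') (stab_susp_morE fh) stab_compE.
apply: stab_susp_morE.
case: gh' fh => [b [bE h'E]] [a [aE hE]]; exists (b \oc a); split.
  by rewrite mcompA -bE -!mcompA aE.
by rewrite mcompA -h'E -!mcompA hE.
Qed.

Definition stab_shift : functor (stab C) (stab C) :=
  @Functor (stab C) (stab C) S stab_susp_mor stab_susp1 stab_suspM.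

(* A conflation [(i, p)] on [X -> Y -> Z] yields the triangle
   [X -> Y -> Z -> SX] whose last map [e] is induced on cokernels by an
   extension [g] of [hull_map X] along [i]. *)
Definition standard_triangle (X Y Z : stab C)
    (u : mor X Y) (v : mor Y Z) (w : mor Z (stab_shift X)) :=
  exists (i : @mor C X Y) (p : @mor C Y Z) (g : @mor C Y (I X))
         (e : @mor C Z (S X)),
    [/\ conflation i p, g \oc i = hull_map IC X & e \oc p = susp_map IC X \oc g]
    /\ [/\ u = stab_proj i, v = stab_proj p & w = stab_proj e].

Definition stab_triangle (X Y Z : stab C)
    (u : mor X Y) (v : mor Y Z) (w : mor Z (stab_shift X)) :=
  exists (X' Y' Z' : stab C)
      (u' : mor X' Y') (v' : mor Y' Z') (w' : mor Z' (stab_shift X')),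
    standard_triangle u' v' w' /\ triangle_isom u' v' w' u v w.

Definition stab_tricat : tricat k :=
  @TriCat k (stab C) stab_shift stab_triangle.

End StableTriangles.

Definition inflations_onto (k : comPzRingType) (C : exact_cat k)
    (I : Type) (G : I -> C) : mor_class C :=
  fun X Y i => exists (N : I) (p : mor Y (G N)), conflation i p.

Definition right_orthogonal (k : comPzRingType) (A : lincat k)
    (I : Type) (G : I -> A) (M : A) :=
  forall (N : I) (f : mor (G N) M), f = 0.

(* A condition on the choice of the covers [P(LN)], met for instance by
   [P(LN) = L(PN)] when [R] is exact.  It cannot be dispensed with when the
   inclusions [0 -> P(LN)] are to be trivial cofibrations, since these must be
   retracts of inflations with cokernel of the form [LN']: if [D = 0], then
   [L = 0], but any projective object of [C] is a possible [P(LN)]. *)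
Definition cover_compatible (k : comPzRingType) (C D : frobenius_cat k)
    (L : functor D C) (PC : projective_choice C) :=
  forall N : D, exists N' : D, direct_summand (proj_cover PC (L N)) (L N').

(* Main.v *)
Require Import Defs.
From mathcomp Require Import all_boot all_algebra.
From mathcomp Require Import boolp.

Set Implicit Arguments.
Unset Strict Implicit.
Unset Printing Implicit Defensive.

Import GRing.Theory.
Local Open Scope ring_scope.

(** The model structure is transferred along [R] from the one on [D] in which
    the cofibrations are the retracts of inflations and the weak equivalences
    are the stable isomorphisms.  In [D], a map lifts against all inflations if and
    only if it is a stable isomorphism that lifts maps out of projectives
    ([inflation_lift_stable_iso]).  By adjunction, [p] is a trivial fibration
    of [C] if and only if it lifts against the images [L j] of inflations of
    [D]; since lifting against an inflation passes to every inflation with the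
    same cokernel that receives it ([has_lift_cokernel]), the images [L j] may
    be replaced by the inflations with cokernel [L N], or by the syzygies
    [S^-1 L N -> P L N].

    A map [X -> Y] is factored into a trivial cofibration and a fibration
    through [X + L Q], where [Q] is a projective cover of [R Y].  For the other
    factorization, pull the conflation [X -> Y + I X -> M] back along the
    counit [L R M -> M] ([mcof_mtfib_factor]): the new conflation has cokernel
    [L R M], and since [R] of the counit is a retraction with injective kernel,
    the map from the pullback to [Y] becomes a trivial fibration.

    The same hypothesis says that [R] of the counit is a stable isomorphism, so
    that the adjunction is stably idempotent.  Its counit is then a stable
    isomorphism exactly at the objects which are left orthogonal to the [M] with
    [R M] injective ([colocal_counit]); those are the objects of [Tria], and
    the stable summands of the [L N] ([Tria_summand]).  Hence [L R] is a
    coreflection of the stable category onto [Tria], which is a localization at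
    the maps inverted by [R] ([coreflective_localization], [cone_perp_iso]); as
    the stable category is itself a localization of [C], so is [Tria]
    ([stab_localization]).  The localization is thus realized by [Tria] with
    the quotient functor [L R]. *)

(** * Isomorphisms, retracts and liftings *)

Section Categories.
Variable C : category.
Implicit Types X Y Z : C.

Lemma is_iso_idm X : is_iso (idm X).
Proof. by exists (idm X); rewrite mcomp1m. Qed.

Lemma is_iso_comp X Y Z (f : mor X Y) (g : mor Y Z) :
  is_iso f -> is_iso g -> is_iso (g \oc f).
Proof.
move=> [f' [f'f ff']] [g' [g'g gg']]; exists (f' \oc g'); split.
  by rewrite mcompA -(mcompA f') g'g mcompm1.
by rewrite mcompA -(mcompA g) ff' mcompm1.
Qed.

Lemma is_iso_cancel_l X Y Z (f : mor X Y) (g : mor Y Z) :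
  is_iso g -> is_iso (g \oc f) -> is_iso f.
Proof.
move=> [g' [g'g gg']] [h [hgf gfh]].
exists (h \oc g); split; first by rewrite -mcompA.
by rewrite -[LHS]mcomp1m -g'g -mcompA (mcompA g f) (mcompA (g \oc f)) gfh mcomp1m.
Qed.

Lemma is_iso_cancel_r X Y Z (f : mor X Y) (g : mor Y Z) :
  is_iso f -> is_iso (g \oc f) -> is_iso g.
Proof.
move=> [f' [f'f ff']] [h [hgf gfh]].
exists (f \oc h); split; last by rewrite mcompA.
by rewrite -[LHS]mcompm1 -ff' mcompA -(mcompA f h) -(mcompA f) -(mcompA h) hgf mcompm1.
Qed.

Lemma retract_mor_trans X Y X' Y' X'' Y''
    (f : mor X Y) (g : mor X' Y') (h : @mor C X'' Y'') :
  retract_mor f g -> retract_mor g h -> retract_mor f h.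
Proof.
move=> [s [r [s' [r' [rs rs' sf fr]]]]] [t [q [t' [q' [qt qt' tg gq]]]]].
exists (t \oc s), (r \oc q), (t' \oc s'), (r' \oc q'); split.
- by rewrite mcompA -(mcompA r) qt mcompm1.
- by rewrite mcompA -(mcompA r') qt' mcompm1.
- by rewrite -mcompA sf mcompA tg mcompA.
- by rewrite mcompA fr -mcompA gq mcompA.
Qed.

Lemma retracts_of_retract (K : mor_class C) X Y (f : mor X Y) :
  retracts_of (retracts_of K) f -> retracts_of K f.
Proof.
move=> [X1 [Y1 [g [[X2 [Y2 [h [Kh gh]]]] fg]]]]; exists X2, Y2, h.
by split=> //; apply: retract_mor_trans fg gh.
Qed.

Lemma retract_mor_refl X Y (f : mor X Y) : retract_mor f f.
Proof. by exists (idm X), (idm X), (idm Y), (idm Y); rewrite !mcomp1m !mcompm1. Qed.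

Lemma retracts_of_sub (K : mor_class C) X Y (f : mor X Y) :
  K X Y f -> retracts_of K f.
Proof. by move=> Kf; exists X, Y, f; split=> //; apply: retract_mor_refl. Qed.

Lemma is_iso_retract X Y X' Y' (f : mor X Y) (g : @mor C X' Y') :
  retract_mor f g -> is_iso g -> is_iso f.
Proof.
move=> [s [r [s' [r' [rs rs' sf fr]]]]] [h [hg gh]]; exists (r \oc h \oc s').
split; first by rewrite -!mcompA sf (mcompA h) hg mcomp1m.
by rewrite !mcompA fr -(mcompA r') gh mcompm1.
Qed.

Lemma has_lift_retract_l A B A' B' X Y (i : mor A B) (j : @mor C A' B')
    (p : @mor C X Y) :
  retract_mor i j -> has_lift j p -> has_lift i p.
Proof.
move=> [s [r [s' [r' [rs rs' sf fr]]]]] jp u v uv.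
have [|h [hj ph]] := jp (u \oc r) (v \oc r').
  by rewrite mcompA uv -!mcompA fr.
exists (h \oc s'); split; first by rewrite -mcompA sf mcompA hj -mcompA rs mcompm1.
by rewrite mcompA ph -mcompA rs' mcompm1.
Qed.

End Categories.

Lemma fmap_iso (C D : category) (F : functor C D) (X Y : C) (f : mor X Y) :
  is_iso f -> is_iso (fmap F f).
Proof.
by move=> [g [gf fg]]; exists (fmap F g); rewrite -!fmapM gf fg !fmap1.
Qed.

Lemma retract_mor_fmap (C D : category) (F : functor C D) (X Y X' Y' : C)
    (f : mor X Y) (g : mor X' Y') :
  retract_mor f g -> retract_mor (fmap F f) (fmap F g).
Proof.
move=> [s [r [s' [r' [rs rs' sf fr]]]]].
exists (fmap F s), (fmap F r), (fmap F s'), (fmap F r').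
by rewrite -!fmapM rs rs' sf fr !fmap1.
Qed.

(** * Exact categories *)

Section Linear.
Variables (k : comPzRingType) (A : lincat k).
Implicit Types X Y Z : A.

Lemma mcompNr X Y Z (g : mor Y Z) (f : mor X Y) : g \oc (- f) = - (g \oc f).
Proof. by rewrite -sub0r mcompBr mcompm0 sub0r. Qed.

Lemma zero_obj_from X Y (f : mor X Y) : idm X = 0 -> f = 0.
Proof. by move=> X0; rewrite -[f]mcompm1 X0 mcompm0. Qed.

Lemma zero_obj_to X Y (f : mor X Y) : idm Y = 0 -> f = 0.
Proof. by move=> Y0; rewrite -[f]mcomp1m Y0 mcomp0m. Qed.

Definition is_biproduct X Y Z
    (i1 : mor X Z) (i2 : mor Y Z) (p1 : mor Z X) (p2 : mor Z Y) :=
  [/\ p1 \oc i1 = idm X, p2 \oc i2 = idm Y, p1 \oc i2 = 0, p2 \oc i1 = 0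
    & i1 \oc p1 + i2 \oc p2 = idm Z].

End Linear.

Section ExactTheory.
Variables (k : comPzRingType) (C : exact_cat k).
Implicit Types X Y Z : C.

Lemma conflation0 X Y Z (i : mor X Y) (p : mor Y Z) :
  conflation i p -> p \oc i = 0.
Proof. by case/conflation_ker. Qed.

Lemma conflation_lift X Y Z (i : mor X Y) (p : mor Y Z) T (f : mor T Y) :
  conflation i p -> p \oc f = 0 -> exists g : mor T X, i \oc g = f.
Proof. by case/conflation_ker=> _ kerP /kerP [g [gE _]]; exists g. Qed.

Lemma conflation_mono X Y Z (i : mor X Y) (p : mor Y Z) T (f g : mor T X) :
  conflation i p -> i \oc f = i \oc g -> f = g.
Proof.
case/conflation_ker=> pi0 kerP ifg.
have /kerP [h [_ hP]] : p \oc (i \oc f) = 0 by rewrite mcompA pi0 mcomp0m.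
by rewrite -(hP f) // -(hP g).
Qed.

Lemma conflation_desc X Y Z (i : mor X Y) (p : mor Y Z) T (f : mor Y T) :
  conflation i p -> f \oc i = 0 -> exists g : mor Z T, g \oc p = f.
Proof. by case/conflation_coker=> _ cokP /cokP [g [gE _]]; exists g. Qed.

Lemma conflation_epi X Y Z (i : mor X Y) (p : mor Y Z) T (f g : mor Z T) :
  conflation i p -> f \oc p = g \oc p -> f = g.
Proof.
case/conflation_coker=> pi0 cokP fgp.
have /cokP [h [_ hP]] : (f \oc p) \oc i = 0 by rewrite -mcompA pi0 mcompm0.
by rewrite -(hP f) // -(hP g).
Qed.

Lemma kernel_conflation X Y Z (i : mor X Y) (p : mor Y Z) :
  deflation p -> is_kernel i p -> conflation i p.
Proof.
move=> [X' [i' cf]] [pi0 kerP].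
have [a [aE _]] := kerP _ i' (conflation0 cf).
have [b bE] := conflation_lift cf pi0.
apply: (conflation_isom (a := a) (b := idm Y) (c := idm Z) _ _ _ _ _ cf);
  rewrite ?mcomp1m ?mcompm1 //; try exact: is_iso_idm.
exists b; split.
  by apply: (conflation_mono cf); rewrite mcompA bE aE mcompm1.
have [c [_ cP]] := kerP _ i pi0.
by rewrite -(cP (idm X)) ?mcompm1 // -(cP (a \oc b)) // mcompA aE bE.
Qed.

Lemma cokernel_conflation X Y Z (i : mor X Y) (p : mor Y Z) :
  inflation i -> is_cokernel p i -> conflation i p.
Proof.
move=> [Z' [p' cf]] [pi0 cokP].
have [a [aE _]] := cokP _ p' (conflation0 cf).
have [b bE] := conflation_desc cf pi0.
apply: (conflation_isom (a := idm X) (b := idm Y) (c := b) _ _ _ _ _ cf);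
  rewrite ?mcomp1m ?mcompm1 //; try exact: is_iso_idm.
exists a; split.
  by apply: (conflation_epi cf); rewrite -mcompA bE aE mcomp1m.
have [c [_ cP]] := cokP _ p pi0.
by rewrite -(cP (idm Z)) ?mcomp1m // -(cP (b \oc a)) // -mcompA aE bE.
Qed.

Lemma inflation_iso X Y Y' (i : mor X Y) (b : mor Y Y') :
  is_iso b -> inflation i -> inflation (b \oc i).
Proof.
move=> isob [Z [p cf]]; have [b' [b'b bb']] := isob.
exists Z, (p \oc b').
apply: (conflation_isom (a := idm X) (b := b) (c := idm Z) _ _ _ _ _ cf);
  rewrite ?mcomp1m ?mcompm1 //; try exact: is_iso_idm.
by rewrite -mcompA b'b mcompm1.
Qed.

Lemma conflation_zero_idm X : conflation (0 : mor (zob C) X) (idm X).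
Proof.
apply: kernel_conflation; first exact: deflation_idm.
split=> [|T f]; first by rewrite mcompm0.
rewrite mcomp1m => f0; exists 0; split=> [|g _]; first by rewrite mcompm0.
by rewrite (zero_obj_to g (zobP C)).
Qed.

Lemma biproduct_conflation X Y Z
    (i1 : mor X Z) (i2 : mor Y Z) (p1 : mor Z X) (p2 : mor Z Y) :
  is_biproduct i1 i2 p1 p2 -> conflation i1 p2.
Proof.
move=> [p1i1 p2i2 p1i2 p2i1 ip].
have inf0 : inflation (0 : mor (zob C) Y).
  by exists Y, (idm Y); apply: conflation_zero_idm.
have [W [f [i [[fi WP] infi]]]] := inflation_pushout (0 : mor (zob C) X) inf0.
have fromW T (h h' : mor W T) : h \oc f = h' \oc f -> h \oc i = h' \oc i -> h = h'.
  move=> hf hi; have [|t [_ tP]] := WP T (h \oc f) (h \oc i).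
    by rewrite !mcompm0.
  by rewrite -(tP h) // -(tP h').
have [|b [[bf bi] _]] := WP Z i2 i1; first by rewrite !mcompm0.
have isob : is_iso b.
  exists (f \oc p2 + i \oc p1); split.
    apply: fromW; rewrite -mcompA ?bf ?bi mcompDl mcomp1m -!mcompA.
      by rewrite p2i2 p1i2 mcompm0 addr0 mcompm1.
    by rewrite p2i1 p1i1 mcompm0 add0r mcompm1.
  by rewrite mcompDr !mcompA bf bi addrC.
apply: cokernel_conflation; first by rewrite -bi; apply: inflation_iso.
split=> // T g gi1; exists (g \oc i2); split=> [|h hp].
  by rewrite -[RHS]mcompm1 -ip mcompDr !mcompA gi1 mcomp0m add0r.
by rewrite -hp -mcompA p2i2 mcompm1.
Qed.

Lemma conflation_pullback X Y Z Z' (i : mor X Y) (p : mor Y Z) (f : mor Z' Z) :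
  conflation i p ->
  exists (Y' : C) (f' : mor Y' Y) (p' : mor Y' Z') (i' : mor X Y'),
    [/\ is_pullback f' p' p f, conflation i' p' & f' \oc i' = i].
Proof.
move=> cf; have defp : deflation p by exists X, i.
have [Y' [f' [p' [pb defp']]]] := deflation_pullback f defp.
exists Y', f', p'; have [sq univ] := pb.
have [|i' [[f'i' p'i'] _]] := univ X i 0.
  by rewrite (conflation0 cf) mcompm0.
exists i'; split=> //; apply: kernel_conflation => //; split=> // T t p't.
have [|s sE] := conflation_lift (f := f' \oc t) cf.
  by rewrite mcompA sq -mcompA p't mcompm0.
exists s; split=> [|s' s'E].
  have [|h [_ hP]] := univ T (f' \oc t) 0; first by rewrite -sE mcompA
    (conflation0 cf) mcomp0m mcompm0.
  rewrite -(hP t) // -(hP (i' \oc s)) // !mcompA f'i' p'i' mcomp0m.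
  by rewrite sE.
by apply: (conflation_mono cf); rewrite sE -s'E mcompA f'i'.
Qed.

(** Lifting against an inflation implies lifting against any inflation with the
    same cokernel that receives it: [B] is the pushout of [j] along the map
    which [m] induces on kernels. *)
Lemma has_lift_cokernel A B Z A' P X Y (i : mor A B) (p : mor B Z)
    (j : mor A' P) (q : mor P Z) (m : mor P B) (f : mor X Y) :
  conflation i p -> conflation j q -> p \oc m = q ->
  @has_lift C _ _ _ _ j f -> @has_lift C _ _ _ _ i f.
Proof.
move=> ip jq pm jf u v uv.
have [|n nE] := conflation_lift (f := m \oc j) ip.
  by rewrite mcompA pm (conflation0 jq).
have [|h [hj fh]] := jf (u \oc n) (v \oc m).
  by rewrite mcompA uv -!mcompA nE.
(* [E] is the fibre product of [B] and [P] over [Z]; it maps onto [B] with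
   kernel [A'], and splits as [A] plus [P], so it glues [u] and [h]. *)
have [E [q' [p' [j' [[sq univ] j'p' q'j']]]]] := conflation_pullback p jq.
have [|a aE] := conflation_lift (f := p' - m \oc q') ip.
  by rewrite mcompBr mcompA pm -sq subrr.
have [|l [[q'l p'l] _]] := univ A 0 i; first by rewrite mcompm0 (conflation0 ip).
have aj' : a \oc j' = - n.
  apply: (conflation_mono ip); rewrite mcompNr nE mcompA aE mcompBl.
  by rewrite (conflation0 j'p') sub0r -mcompA q'j'.
have al : a \oc l = idm A.
  apply: (conflation_mono ip).
  by rewrite mcompA aE mcompBl p'l -mcompA q'l mcompm0 subr0 mcompm1.
have [|w wE] := conflation_desc (f := u \oc a + h \oc q') j'p'.
  by rewrite mcompDl -!mcompA aj' q'j' hj mcompNr addNr.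
exists w; split.
  by rewrite -p'l mcompA wE mcompDl -!mcompA al q'l mcompm0 addr0 mcompm1.
apply: (conflation_epi j'p').
rewrite -mcompA wE mcompDr !mcompA uv fh -!mcompA -(mcompDr v) aE.
by rewrite subrK.
Qed.

(** The conflation starting with [(f, j)], from [X] to the sum of [Y] and [J]:
    [(f, 1)] is a split inflation into the sum of [Y] and [X], and [E] is the
    pushout of [j] along the inclusion of [X] there. *)
Lemma cone_conflation X Y J (f : mor X Y) (j : mor X J) :
  inflation j ->
  exists (E M : C) (a : mor X E) (b : mor E M)
      (iY : mor Y E) (iJ : mor J E) (pY : mor E Y) (pJ : mor E J),
    [/\ is_biproduct iY iJ pY pJ, conflation a b, pY \oc a = f & pJ \oc a = j].
Proof.
move=> infj.
have [W [iY [iX [pY [pX [pYiY pXiX pYiX pXiY ip]]]]]] := biproduct Y X.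
have [E [k' [i' [[sq univ] infi']]]] := inflation_pushout iX infj.
have fromE T (h h' : mor E T) : h \oc k' = h' \oc k' -> h \oc i' = h' \oc i' -> h = h'.
  move=> hk hi; have [|t [_ tP]] := univ T (h \oc k') (h \oc i').
    by rewrite -!mcompA sq.
  by rewrite -(tP h) // -(tP h').
have [|pY' [[pY'k pY'i] _]] := univ Y 0 pY; first by rewrite mcomp0m pYiX.
have [|pJ [[pJk pJi] _]] := univ J (idm J) (j \oc pX).
  by rewrite mcomp1m -mcompA pXiX mcompm1.
have [Z [p cf]] : inflation (iX + iY \oc f).
  have -> : iX + iY \oc f = (idm W + iY \oc f \oc pX) \oc iX.
    by rewrite mcompDl mcomp1m -!mcompA pXiX mcompm1.
  apply: inflation_iso; last first.
    exists Y, pY; apply: (@biproduct_conflation _ _ _ _ iY pX pY).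
    by split=> //; rewrite addrC.
  have sq0 : (iY \oc f \oc pX) \oc (iY \oc f \oc pX) = 0.
    by rewrite -!mcompA (mcompA pX) pXiY mcomp0m !mcompm0.
  exists (idm W - iY \oc f \oc pX); split.
    by rewrite mcompBl mcomp1m mcompDr mcompm1 sq0 addr0 addrK.
  by rewrite mcompDl mcomp1m mcompBr mcompm1 sq0 subr0 subrK.
have infX : inflation (i' \oc (iX + iY \oc f)).
  by apply: inflation_comp => //; exists Z, p.
have [M [b ab]] := infX.
exists E, M, (i' \oc (iX + iY \oc f)), b, (i' \oc iY), k', pY', pJ; split=> //.
- split=> //; first by rewrite mcompA pY'i.
    by rewrite mcompA pJi -mcompA pXiY mcompm0.
  apply: fromE; rewrite mcompDl -!mcompA mcomp1m.
    by rewrite pY'k pJk !mcompm0 add0r mcompm1.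
  by rewrite pY'i pJi !mcompA sq -!mcompA -mcompDr ip mcompm1.
- by rewrite mcompA pY'i mcompDr mcompA pYiX pYiY mcomp1m add0r.
- by rewrite mcompA pJi mcompDr -!mcompA (mcompA pX) pXiX pXiY mcomp0m !mcompm0
    mcompm1 addr0.
Qed.

Lemma conflation_section X Y Z (i : mor X Y) (p : mor Y Z) (r : mor Y X) :
  conflation i p -> r \oc i = idm X ->
  exists t : mor Z Y, is_biproduct i t r p.
Proof.
move=> ip ri; have [|t tE] := conflation_desc (f := idm Y - i \oc r) ip.
  by rewrite mcompBl mcomp1m -mcompA ri mcompm1 subrr.
exists t; split=> //; last by rewrite tE addrC subrK.
- apply: (conflation_epi ip); rewrite -mcompA tE mcompBr mcompA.
  by rewrite (conflation0 ip) mcomp0m subr0 mcompm1 mcomp1m.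
- apply: (conflation_epi ip); rewrite -mcompA tE mcompBr mcompA ri.
  by rewrite mcompm1 mcomp1m subrr mcomp0m.
- exact: conflation0 ip.
Qed.

Lemma conflation_retraction X Y Z (i : mor X Y) (p : mor Y Z) (t : mor Z Y) :
  conflation i p -> p \oc t = idm Z ->
  exists r : mor Y X, is_biproduct i t r p.
Proof.
move=> ip pt; have [|r rE] := conflation_lift (f := idm Y - t \oc p) ip.
  by rewrite mcompBr mcompm1 mcompA pt mcomp1m subrr.
exists r; split=> //; last by rewrite rE subrK.
- apply: (conflation_mono ip); rewrite mcompA rE mcompBl -mcompA.
  by rewrite (conflation0 ip) mcompm0 subr0 mcompm1 mcomp1m.
- apply: (conflation_mono ip); rewrite mcompA rE mcompBl -mcompA pt.
  by rewrite mcompm1 mcomp1m subrr mcompm0.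
- exact: conflation0 ip.
Qed.

Lemma injective_summand X Y (s : mor X Y) (r : mor Y X) :
  r \oc s = idm X -> injective_obj Y -> injective_obj X.
Proof.
move=> rs Yinj A B i f infi; have [g gE] := Yinj A B i (s \oc f) infi.
by exists (r \oc g); rewrite -mcompA gE mcompA rs mcomp1m.
Qed.

Lemma injective_biproduct X Y Z
    (i1 : mor X Z) (i2 : mor Y Z) (p1 : mor Z X) (p2 : mor Z Y) :
  is_biproduct i1 i2 p1 p2 -> injective_obj X -> injective_obj Y ->
  injective_obj Z.
Proof.
move=> [_ _ _ _ ip] Xinj Yinj A B i f infi.
have [g gE] := Xinj A B i (p1 \oc f) infi.
have [h hE] := Yinj A B i (p2 \oc f) infi.
exists (i1 \oc g + i2 \oc h).
by rewrite mcompDl -!mcompA gE hE !mcompA -mcompDl ip mcomp1m.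
Qed.

End ExactTheory.

(** * Stable morphisms of a Frobenius category *)

Section FrobeniusTheory.
Variables (k : comPzRingType) (C : frobenius_cat k).
Implicit Types X Y Z : C.

Lemma stably_nullE X Y (f : mor X Y) : stably_null f <-> stab_proj f = 0.
Proof. by rewrite -[in X in X <-> _](subr0 f); apply: iff_sym; apply: stab_projP. Qed.

Lemma stably_nullD X Y (f g : mor X Y) :
  stably_null f -> stably_null g -> stably_null (f + g).
Proof. by move=> fN gN; rewrite -[f]scale1r; apply: stably_nullP. Qed.

Lemma stably_nullN X Y (f : mor X Y) : stably_null f -> stably_null (- f).
Proof.
move=> fN; rewrite -[- f]addr0 -scaleN1r.
by apply: stably_nullP => //; apply: stably_null0.
Qed.

Lemma stably_nullB X Y (f g : mor X Y) :
  stably_null f -> stably_null g -> stably_null (f - g).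
Proof. by move=> fN gN; apply: stably_nullD => //; apply: stably_nullN. Qed.

Lemma stably_null_to_injective X Y (f : mor X Y) :
  injective_obj Y -> stably_null f.
Proof. by move=> Yinj; exists Y, f, (idm Y); rewrite mcomp1m. Qed.

Lemma stably_null_from_injective X Y (f : mor X Y) :
  injective_obj X -> stably_null f.
Proof. by move=> Xinj; exists X, (idm X), f; rewrite mcompm1. Qed.

Lemma stably_null_idm X : stably_null (idm X) <-> injective_obj X.
Proof.
split=> [[J [u [v [Jinj uv]]]]|]; last exact: stably_null_to_injective.
exact: injective_summand (esym uv) Jinj.
Qed.

Lemma stably_null_extend X Y Z W (i : mor X Y) (p : mor Y Z) (f : mor X W) :
  conflation i p -> stably_null f ->
  exists g : mor Y W, g \oc i = f /\ stably_null g.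
Proof.
move=> ip [J [u [v [Jinj ->]]]].
have infi : inflation i by exists Z, p.
have [w wE] := Jinj _ _ i u infi.
by exists (v \oc w); rewrite -mcompA wE; split=> //; exists J, w, v.
Qed.

Lemma stably_null_lift X Y Z W (i : mor X Y) (p : mor Y Z) (f : mor W Z) :
  conflation i p -> stably_null f ->
  exists g : mor W Y, p \oc g = f /\ stably_null g.
Proof.
move=> ip [J [u [v [Jinj ->]]]].
have defp : deflation p by exists X, i.
have [w wE] := (injective_projective J).1 Jinj _ _ p v defp.
by exists (w \oc u); rewrite mcompA wE; split=> //; exists J, u, w.
Qed.

Lemma stable_isoP X Y (f : mor X Y) :
  stable_iso f <-> exists g : mor Y X,
    stably_null (idm X - g \oc f) /\ stably_null (idm Y - f \oc g).
Proof.
split=> [[g [gf fg]]|[g [gf fg]]].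
  exists (stab_rep g); split; apply/stab_projP;
    rewrite -stab_compE stab_repK; exact: esym.
exists (stab_proj g); split; apply: esym.
  by apply: (etrans ((stab_projP _ _).2 gf)); rewrite -stab_compE.
by apply: (etrans ((stab_projP _ _).2 fg)); rewrite -stab_compE.
Qed.

Lemma stable_iso_section X Y (s : mor X Y) (r : mor Y X) :
  r \oc s = idm X -> stably_null (idm Y - s \oc r) -> stable_iso s /\ stable_iso r.
Proof.
move=> rs sr; split; apply/stable_isoP; [exists r | exists s];
  by rewrite rs subrr; split=> //; apply: stably_null0.
Qed.

Lemma stable_iso_biproduct X Y Z
    (i1 : mor X Z) (i2 : mor Y Z) (p1 : mor Z X) (p2 : mor Z Y) :
  is_biproduct i1 i2 p1 p2 -> injective_obj Y -> stable_iso i1 /\ stable_iso p1.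
Proof.
move=> [p1i1 _ _ _ ip] Yinj; apply: stable_iso_section => //.
by rewrite -ip addrC addKr; exists Y, p2, i2.
Qed.

Lemma conflation_injective_coker X Y Z (i : mor X Y) (p : mor Y Z) :
  conflation i p -> injective_obj Z ->
  exists (t : mor Z Y) (r : mor Y X), is_biproduct i t r p.
Proof.
move=> ip /injective_projective Zproj.
have defp : deflation p by exists X, i.
have [t /(conflation_retraction ip) [r rt]] := Zproj _ _ p (idm Z) defp.
by exists t, r.
Qed.

Lemma conflation_injective_ker X Y Z (i : mor X Y) (p : mor Y Z) :
  conflation i p -> injective_obj X ->
  exists (t : mor Z Y) (r : mor Y X), is_biproduct i t r p.
Proof.
move=> ip Xinj; have infi : inflation i by exists Z, p.
have [r /(conflation_section ip) [t rt]] := Xinj _ _ i (idm X) infi.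
by exists t, r.
Qed.

Lemma injective_conflation X Y Z (i : mor X Y) (p : mor Y Z) :
  conflation i p ->
  [/\ injective_obj X -> injective_obj Y -> injective_obj Z,
      injective_obj Y -> injective_obj Z -> injective_obj X
    & injective_obj X -> injective_obj Z -> injective_obj Y].
Proof.
move=> ip; split.
- move=> Xinj; have [t [r [_ pt _ _ _]]] := conflation_injective_ker ip Xinj.
  exact: injective_summand pt.
- move=> Yinj Zinj; have [t [r [ri _ _ _ _]]] := conflation_injective_coker ip Zinj.
  exact: injective_summand ri Yinj.
- move=> Xinj Zinj; have [t [r bi]] := conflation_injective_ker ip Xinj.
  exact: injective_biproduct bi Xinj Zinj.
Qed.

Lemma stable_iso_conflation X Y Z (i : mor X Y) (p : mor Y Z) :
  conflation i p -> stable_iso i <-> injective_obj Z.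
Proof.
move=> ip; split=> [/stable_isoP [s [si is_]]|Zinj]; last first.
  have [t [r bi]] := conflation_injective_coker ip Zinj.
  by have [] := stable_iso_biproduct bi Zinj.
(* The stable inverse [s] is corrected to an honest retraction of [i]. *)
have [c [ci cN]] := stably_null_extend ip si.
have [|t [_ pt _ _ ip1]] := conflation_section (r := s + c) ip.
  by rewrite mcompDl ci addrC subrK.
have tpN : stably_null (t \oc p).
  have -> : t \oc p = (idm Y - i \oc s) - i \oc c.
    by rewrite -ip1 mcompDr -[RHS]addrA -opprD addrAC subrr add0r.
  by apply: stably_nullB => //; apply: stably_null_compl.
apply/stably_null_idm.
have -> : idm Z = p \oc (t \oc p) \oc t by rewrite mcompA pt mcomp1m.
by apply: stably_null_compr; apply: stably_null_compl.
Qed.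

(** With an injective middle term in the target, the map which [f] induces on
    cokernels depends, stably, on the stable class of [f] alone. *)
Lemma cokernel_map_null X Y Z X' Y' Z' (i : mor X Y) (p : mor Y Z)
    (i' : mor X' Y') (p' : mor Y' Z') (f : mor X X') (g : mor Y Y') (h : mor Z Z') :
  conflation i p -> p' \oc i' = 0 -> injective_obj Y' ->
  g \oc i = i' \oc f -> h \oc p = p' \oc g -> stably_null f -> stably_null h.
Proof.
move=> ip pi' Y'inj gi hp fN.
have [w [wi wN]] := stably_null_extend ip fN.
have [|c cp] := conflation_desc (f := g - i' \oc w) ip.
  by rewrite mcompBl gi -mcompA wi subrr.
exists Y', c, p'; split=> //; apply: (conflation_epi ip).
by rewrite hp -mcompA cp mcompBr mcompA pi' mcomp0m subr0.
Qed.

(** * Right lifting property against inflations *)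

Definition lifts_projectives X Y (r : mor X Y) :=
  forall (Q : C) (b : mor Q Y), projective_obj Q -> exists a : mor Q X, r \oc a = b.

(** A map right orthogonal to all inflations has a section, because it lifts
    against [0 -> Y], and lifting against an injective hull of [X] shows that
    the complementary idempotent factors through an injective.  Conversely a
    stable inverse is corrected to an honest section by lifting the
    projective through which the defect factors. *)
Lemma inflation_lift_stable_iso X Y (r : mor X Y) :
  (forall (A B : C) (i : mor A B), inflation i -> has_lift i r) <->
  lifts_projectives r /\ stable_iso r.
Proof.
have section : (forall A B (i : mor A B), inflation i -> has_lift i r) ->
    forall (B : C) (b : mor B Y), exists a, r \oc a = b.
  move=> rlp B b; have inf0 : inflation (0 : mor (zob C) B).
    by exists B, (idm B); apply: conflation_zero_idm.
  have [|h [_ hE]] := rlp _ _ _ inf0 0 b; first by rewrite !mcompm0.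
  by exists h.
split=> [rlp|[rproj /stable_isoP [s [sr rs]]] A B i [Z [p ip]] u v ruvi].
  split=> [Q b _|]; first exact: section.
  have [s rs] := section rlp _ (idm Y).
  apply: (stable_iso_section rs _).2 => //.
  have [J [j [Jinj infj]]] := enough_injectives X.
  have [|h [hj rh]] := rlp _ _ j infj (idm X - s \oc r) 0.
    by rewrite mcompBr mcompm1 mcompA rs mcomp1m subrr mcomp0m.
  by exists J, j, h.
have [J [a [b [Jinj ab]]]] := rs.
have [b' b'E] := rproj J b ((injective_projective J).1 Jinj).
pose s' := s + b' \oc a.
have rs' : r \oc s' = idm Y by rewrite mcompDr mcompA b'E -ab addrC subrK.
have s'N : stably_null ((idm X - s' \oc r) \oc u).
  apply: stably_null_compr; rewrite mcompDl opprD addrA; apply: stably_nullB => //.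
  by exists J, (a \oc r), b'; rewrite mcompA.
have [w [wi _]] := stably_null_extend ip s'N.
(* [s' v] solves the problem up to the part of [u] in the kernel of [r]; this
   part is stably null, so it extends along [i]. *)
exists (s' \oc v + (idm X - s' \oc r) \oc w).
have rc : r \oc (idm X - s' \oc r) = 0.
  by rewrite mcompBr mcompm1 mcompA rs' mcomp1m subrr.
have cc : (idm X - s' \oc r) \oc (idm X - s' \oc r) = idm X - s' \oc r.
  by rewrite mcompBl mcomp1m -mcompA rc mcompm0 subr0.
split; last by rewrite mcompDr !mcompA rs' mcomp1m rc mcomp0m addr0.
rewrite mcompDl -!mcompA wi -ruvi (mcompA (idm X - s' \oc r)) cc mcompA.
by rewrite mcompBl mcomp1m addrC subrK.
Qed.

(** * Orthogonality in the stable category *)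

(** The stable Hom into [M] gives a long exact sequence; here its connecting
    steps are replaced by embedding [M] into an injective, or covering it by a
    projective, and [K] contains the resulting cosyzygies and syzygies. *)
Lemma left_orthogonal_conflation (K : C -> Prop) :
  (forall (A B M : C) (i : mor A B) (p : mor B M),
     conflation i p -> injective_obj B -> K A <-> K M) ->
  let orth X := forall (M : C) (f : mor X M), K M -> stably_null f in
  forall X Y Z (i : mor X Y) (p : mor Y Z), conflation i p ->
  [/\ orth X -> orth Y -> orth Z, orth Y -> orth Z -> orth X
    & orth X -> orth Z -> orth Y].
Proof.
move=> Kshift orth X Y Z i p ip; split.
- move=> Xo Yo M f KM.
  have [P [c [Pproj [M' [d dc]]]]] := enough_projectives M.
  have Pinj := (injective_projective P).2 Pproj.
  have [h [ch _]] := stably_null_lift dc (Yo M (f \oc p) KM).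
  have [|l dl] := conflation_lift (f := h \oc i) dc.
    by rewrite mcompA ch -mcompA (conflation0 ip) mcompm0.
  have [l' [l'i _]] :=
    stably_null_extend ip (Xo M' l ((Kshift _ _ _ _ _ dc Pinj).2 KM)).
  have [|t tp] := conflation_desc (f := h - d \oc l') ip.
    by rewrite mcompBl -mcompA l'i dl subrr.
  exists P, t, c; split=> //; apply: (conflation_epi ip).
  by rewrite -mcompA tp mcompBr ch mcompA (conflation0 dc) mcomp0m subr0.
- move=> Yo Zo M f KM.
  have [J [j [Jinj [M' [q jq]]]]] := enough_injectives M.
  have infi : inflation i by exists Z, p.
  have [g gi] := Jinj _ _ i (j \oc f) infi.
  have [|h hp] := conflation_desc (f := q \oc g) ip.
    by rewrite -mcompA gi mcompA (conflation0 jq) mcomp0m.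
  have [h' [qh' _]] := stably_null_lift jq (Zo M' h ((Kshift _ _ _ _ _ jq Jinj).1 KM)).
  have [|m jm] := conflation_lift (f := g - h' \oc p) jq.
    by rewrite mcompBr mcompA qh' hp subrr.
  suff -> : f = m \oc i by apply: stably_null_compr; apply: Yo.
  apply: (conflation_mono jq); rewrite mcompA jm mcompBl gi -mcompA.
  by rewrite (conflation0 ip) mcompm0 subr0.
- move=> Xo Zo M f KM.
  have [l [li lN]] := stably_null_extend ip (Xo M (f \oc i) KM).
  have [|t tp] := conflation_desc (f := f - l) ip.
    by rewrite mcompBl li subrr.
  rewrite -(subrK l f) -tp; apply: stably_nullD => //.
  by apply: stably_null_compr; apply: Zo.
Qed.

End FrobeniusTheory.

(** * Additive and exact functors *)

Section AdditiveFunctors.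
Variables (k : comPzRingType) (A B : lincat k) (F : functor A B).
Hypothesis F_add : additive_functor F.
Implicit Types X Y Z : A.

Lemma additive_fmap0 X Y : fmap F (0 : mor X Y) = 0.
Proof. by apply: (addrI (fmap F (0 : mor X Y))); rewrite -F_add !addr0. Qed.

Lemma additive_fmapB X Y (f g : mor X Y) : fmap F (f - g) = fmap F f - fmap F g.
Proof. by apply/eqP; rewrite eq_sym subr_eq -F_add subrK. Qed.

Lemma additive_biproduct X Y Z
    (i1 : mor X Z) (i2 : mor Y Z) (p1 : mor Z X) (p2 : mor Z Y) :
  is_biproduct i1 i2 p1 p2 ->
  is_biproduct (fmap F i1) (fmap F i2) (fmap F p1) (fmap F p2).
Proof.
move=> [p1i1 p2i2 p1i2 p2i1 ip]; split; rewrite -!fmapM ?p1i1 ?p2i2 ?fmap1 //.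
- by rewrite p1i2 additive_fmap0.
- by rewrite p2i1 additive_fmap0.
- by rewrite -F_add ip fmap1.
Qed.

End AdditiveFunctors.

Section ExactFunctors.
Variables (k : comPzRingType) (C D : frobenius_cat k) (F : functor C D).
Hypothesis F_inj : forall J : C, injective_obj J -> injective_obj (F J).

Lemma fmap_stably_null (X Y : C) (f : mor X Y) :
  stably_null f -> stably_null (fmap F f).
Proof.
move=> [J [u [v [Jinj ->]]]]; exists (F J), (fmap F u), (fmap F v).
by rewrite fmapM; split=> //; apply: F_inj.
Qed.

Lemma fmap_stable_iso (X Y : C) (f : mor X Y) :
  additive_functor F -> stable_iso f -> stable_iso (fmap F f).
Proof.
move=> F_add /stable_isoP [g [gf fg]]; apply/stable_isoP; exists (fmap F g).
by rewrite -!fmapM -!fmap1 -!additive_fmapB //; split; apply: fmap_stably_null.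
Qed.

End ExactFunctors.

(** * Adjoint transposition *)

Section Transposition.
Variables (C D : category) (L : functor D C) (R : functor C D).
Variable adj : adjunction L R.

Definition transpose (N : D) (M : C) (f : mor (L N) M) : mor N (R M) :=
  fmap R f \oc adj_unit adj N.

Definition untranspose (N : D) (M : C) (g : mor N (R M)) : mor (L N) M :=
  adj_counit adj M \oc fmap L g.

Lemma unit_natE (N N' : D) (g : mor N N') :
  adj_unit adj N' \oc g = fmap R (fmap L g) \oc adj_unit adj N.
Proof. exact: (unit_nat adj g). Qed.

Lemma counit_natE (M M' : C) (f : mor M M') :
  adj_counit adj M' \oc fmap L (fmap R f) = f \oc adj_counit adj M.
Proof. exact: (counit_nat adj f). Qed.

Lemma transposeK N M (f : mor (L N) M) : untranspose (transpose f) = f.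
Proof.
rewrite /untranspose /transpose fmapM mcompA counit_natE -mcompA adj_triL.
exact: mcompm1.
Qed.

Lemma untransposeK N M (g : mor N (R M)) : transpose (untranspose g) = g.
Proof.
rewrite /untranspose /transpose fmapM -mcompA -unit_natE mcompA adj_triR.
exact: mcomp1m.
Qed.

Lemma transpose_compl N M M' (g : mor M M') (f : mor (L N) M) :
  transpose (g \oc f) = fmap R g \oc transpose f.
Proof. by rewrite /transpose fmapM mcompA. Qed.

Lemma transpose_compr N N' M (f : mor (L N') M) (n : mor N N') :
  transpose (f \oc fmap L n) = transpose f \oc n.
Proof. by rewrite /transpose fmapM -!mcompA unit_natE. Qed.

Lemma untranspose_compl N M M' (g : mor M M') (f : mor N (R M)) :
  untranspose (fmap R g \oc f) = g \oc untranspose f.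
Proof. by rewrite /untranspose fmapM !mcompA counit_natE. Qed.

Lemma untranspose_compr N N' M (f : mor N' (R M)) (n : mor N N') :
  untranspose (f \oc n) = untranspose f \oc fmap L n.
Proof. by rewrite /untranspose fmapM mcompA. Qed.

Lemma has_lift_adjoint (A B : D) (X Y : C) (j : mor A B) (p : mor X Y) :
  has_lift (fmap L j) p <-> has_lift j (fmap R p).
Proof.
split=> jp u v uv.
  have [|h [hj ph]] := jp (untranspose u) (untranspose v).
    by rewrite -untranspose_compl -untranspose_compr uv.
  exists (transpose h).
  by rewrite -transpose_compr -transpose_compl hj ph !untransposeK.
have [|h [hj ph]] := jp (transpose u) (transpose v).
  by rewrite -transpose_compl -transpose_compr uv.
exists (untranspose h).
by rewrite -untranspose_compr -untranspose_compl hj ph !transposeK.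
Qed.

Lemma right_adjoint_pullback (W X Y Z : C)
    (g' : mor W Y) (f' : mor W Z) (f : mor Y X) (g : mor Z X) :
  is_pullback g' f' f g ->
  is_pullback (fmap R g') (fmap R f') (fmap R f) (fmap R g).
Proof.
move=> [sq univ]; split=> [|T u v uv]; first by rewrite -!fmapM sq.
have [|h [[g'h f'h] hP]] := univ _ (untranspose u) (untranspose v).
  by rewrite -!untranspose_compl uv.
exists (transpose h); split=> [|h' [h'u h'v]].
  by rewrite -!transpose_compl g'h f'h !untransposeK.
rewrite -(untransposeK h'); congr transpose; apply: hP.
by rewrite -!untranspose_compl h'u h'v.
Qed.

End Transposition.

(** * The model structure *)

Section Model.
Variables (k : comPzRingType) (C D : frobenius_cat k).
Variables (L : functor D C) (R : functor C D).
Hypotheses (L_exact : exact_functor L) (R_exact : exact_functor R).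
Variable adj : adjunction L R.

Lemma left_adjoint_projective (Q : D) : projective_obj Q -> projective_obj (L Q).
Proof.
move=> Qproj Y Z p f [X [i ip]].
have defRp : deflation (fmap R p) by exists (R X), (fmap R i); apply: R_exact.2.
have [g gE] := Qproj _ _ _ (transpose adj f) defRp.
by exists (untranspose adj g); rewrite -untranspose_compl gE transposeK.
Qed.

Lemma left_adjoint_injective (J : D) : injective_obj J -> injective_obj (L J).
Proof. by rewrite !injective_projective; apply: left_adjoint_projective. Qed.

Lemma right_adjoint_injective (J : C) : injective_obj J -> injective_obj (R J).
Proof.
move=> Jinj X Y i f [Z [p ip]].
have infLi : inflation (fmap L i) by exists (L Z), (fmap L p); apply: L_exact.2.
have [g gE] := Jinj _ _ _ (untranspose adj f) infLi.
by exists (transpose adj g); rewrite -transpose_compr gE untransposeK.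
Qed.

Definition mcof : mor_class C := retracts_of (inflations_onto (fun N : D => L N)).
(** The fibrations are described through [R], by lifting maps out of
    projectives of [D]; by adjunction this is the right lifting property
    against [0 -> L Q] for [Q] projective, which makes no reference to a choice
    of projective covers in [C]. *)
Definition mfib : mor_class C := fun X Y f => lifts_projectives (fmap R f).
Definition mweq : mor_class C := fun X Y f => stable_iso (fmap R f).

Lemma mweq_comp X Y Z (f : mor X Y) (g : mor Y Z) :
  mweq f -> mweq g -> mweq (g \oc f).
Proof. by rewrite /mweq /stable_iso !fmapM; apply: is_iso_comp. Qed.

Lemma mweq_cancel_l X Y Z (f : mor X Y) (g : mor Y Z) :
  mweq g -> mweq (g \oc f) -> mweq f.
Proof. by rewrite /mweq /stable_iso !fmapM; apply: is_iso_cancel_l. Qed.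

Lemma mweq_cancel_r X Y Z (f : mor X Y) (g : mor Y Z) :
  mweq f -> mweq (g \oc f) -> mweq g.
Proof. by rewrite /mweq /stable_iso !fmapM; apply: is_iso_cancel_r. Qed.

Lemma mweq_retract X Y (f : mor X Y) : retracts_of mweq f -> mweq f.
Proof.
move=> [X' [Y' [g [gw fg]]]]; apply: is_iso_retract gw.
by do 2 apply: retract_mor_fmap.
Qed.

Lemma mfib_lift X Y (p : mor X Y) Q (v : mor (L Q) Y) :
  mfib p -> projective_obj Q -> exists l, p \oc l = v.
Proof.
move=> fp Qproj; have [a aE] := fp Q (transpose adj v) Qproj.
by exists (untranspose adj a); rewrite -untranspose_compl aE transposeK.
Qed.

Lemma mfib_from_lift X Y (p : mor X Y) :
  (forall Q (v : mor (L Q) Y), projective_obj Q -> exists l, p \oc l = v) ->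
  mfib p.
Proof.
move=> lp Q b Qproj; have [l lE] := lp Q (untranspose adj b) Qproj.
by exists (transpose adj l); rewrite -transpose_compl lE untransposeK.
Qed.

Lemma mfib_retract X Y (f : mor X Y) : retracts_of mfib f -> mfib f.
Proof.
move=> [X' [Y' [g [fg [s [r [s' [r' [rs rs' sf fr]]]]]]]]].
apply: mfib_from_lift => Q v Qproj.
have [l lE] := mfib_lift (s' \oc v) fg Qproj.
by exists (r \oc l); rewrite mcompA fr -mcompA lE mcompA rs' mcomp1m.
Qed.

(** By adjunction, a fibration which is a weak equivalence is the same as a
    map [p] such that [R p] lifts against the inflations of [D], that is, such
    that [p] lifts against their images under [L]; every inflation with
    cokernel [L N] is a pushout of such an image. *)
Lemma mtfib_has_lift X Y (p : mor X Y) A B (i : mor A B) :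
  mfib p -> mweq p -> inflations_onto (fun N : D => L N) i -> has_lift i p.
Proof.
move=> fp wp [N [q iq]].
have [P [c [Pproj [N' [j jc]]]]] := enough_projectives N.
have infj : inflation j by exists N, c.
have /(has_lift_adjoint adj) jp :=
  (inflation_lift_stable_iso _).2 (conj fp wp) _ _ j infj.
have defq : deflation q by exists A, i.
have [m mE] := left_adjoint_projective Pproj (fmap L c) defq.
exact: has_lift_cokernel iq (L_exact.2 _ _ _ _ _ jc) mE jp.
Qed.

(** The converse direction transports the lifting property from the cover of
    [L N] to the image under [L] of any inflation with cokernel [N]. *)
Lemma mtfib_cover (PC : projective_choice C) X Y (p : mor X Y) :
  mfib p /\ mweq p <-> forall N : D, has_lift (desusp_map PC (L N)) p.
Proof.
split=> [[fp wp] N|lp].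
  apply: mtfib_has_lift => //; exists N, (cover_map PC (L N)).
  exact: cover_conflation.
apply/inflation_lift_stable_iso => A B j [N [c jc]].
apply/(has_lift_adjoint adj).
have LjLc := L_exact.2 _ _ _ _ _ jc.
have defLc : deflation (fmap L c) by exists (L A), (fmap L j).
have [m mE] :=
  @cover_projective k C PC (L N) _ _ _ (cover_map PC (L N)) defLc.
exact: has_lift_cokernel LjLc (cover_conflation PC (L N)) mE (lp N).
Qed.

Lemma mcof_mtfib_lift A B X Y (i : mor A B) (p : mor X Y) :
  mcof i -> mfib p -> mweq p -> has_lift i p.
Proof.
move=> [A' [B' [j [jL ij]]]] fp wp; apply: has_lift_retract_l ij _.
exact: mtfib_has_lift.
Qed.

Lemma biproduct_mcof X W N
    (i1 : mor X W) (i2 : mor (L N) W) (p1 : mor W X) (p2 : mor W (L N)) :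
  is_biproduct i1 i2 p1 p2 -> mcof i1.
Proof.
move=> bi; apply: retracts_of_sub; exists N, p2.
exact: biproduct_conflation bi.
Qed.

Lemma biproduct_mweq X Y W
    (i1 : mor X W) (i2 : mor Y W) (p1 : mor W X) (p2 : mor W Y) :
  is_biproduct i1 i2 p1 p2 -> injective_obj Y -> mweq i1 /\ mweq p1.
Proof.
move=> bi Yinj; apply: stable_iso_biproduct (right_adjoint_injective Yinj).
exact: (additive_biproduct R_exact.1 bi).
Qed.

Lemma biproduct_mfib_lift A X Y W Q (p : mor X Y)
    (i1 : mor A W) (i2 : mor (L Q) W) (p1 : mor W A) (p2 : mor W (L Q)) :
  is_biproduct i1 i2 p1 p2 -> projective_obj Q -> mfib p -> has_lift i1 p.
Proof.
move=> [p1i1 _ _ p2i1 ip] Qproj fp u v uv.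
have [l lE] := mfib_lift (v \oc i2) fp Qproj.
exists (u \oc p1 + l \oc p2); split.
  by rewrite mcompDl -!mcompA p1i1 p2i1 mcompm0 addr0 mcompm1.
by rewrite mcompDr !mcompA uv lE -!mcompA -mcompDr ip mcompm1.
Qed.

(** Add to [X] the image under [L] of a projective cover of [R Y]. *)
Lemma mtcof_mfib_factor X Y (f : mor X Y) :
  exists (Q : D) (W : C) (i1 : mor X W) (i2 : mor (L Q) W) (p1 : mor W X)
      (p2 : mor W (L Q)) (g : mor W Y),
    [/\ projective_obj Q, is_biproduct i1 i2 p1 p2, g \oc i1 = f & mfib g].
Proof.
have [Q [q [Qproj defq]]] := enough_projectives (R Y).
have [W [i1 [i2 [p1 [p2 bi]]]]] := biproduct X (L Q).
have [p1i1 p2i2 p1i2 p2i1 ip] := bi.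
have [q' q'E] : exists q', transpose adj q' = q.
  by exists (untranspose adj q); rewrite untransposeK.
exists Q, W, i1, i2, p1, p2, (f \oc p1 + q' \oc p2); split=> //.
  by rewrite mcompDl -!mcompA p1i1 p2i1 mcompm0 addr0 mcompm1.
apply: mfib_from_lift => Q' v Q'proj.
have [c cE] := Q'proj _ _ q (transpose adj v) defq.
exists (i2 \oc fmap L c).
rewrite mcompDl -!mcompA !(mcompA p1) !(mcompA p2) p1i2 p2i2 mcomp0m mcompm0.
by rewrite add0r mcomp1m -(transposeK adj q') -untranspose_compr q'E cE transposeK.
Qed.

(** Factor [i] as the injection [i1 : A -> A + L Q] followed by a fibration
    [g].  Two-out-of-three makes [g] a trivial fibration, so [i] lifts against
    it and is a retract of [i1]. *)
Lemma mtcof_retract A B (i : mor A B) : mcof i -> mweq i ->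
  exists (Q : D) (W : C) (i1 : mor A W) (i2 : mor (L Q) W) (p1 : mor W A)
      (p2 : mor W (L Q)),
    [/\ projective_obj Q, is_biproduct i1 i2 p1 p2 & retract_mor i i1].
Proof.
move=> ci wi; have [Q [W [i1 [i2 [p1 [p2 [g [Qproj bi gi1 fg]]]]]]]] :=
  mtcof_mfib_factor i.
exists Q, W, i1, i2, p1, p2; split=> //.
have LQinj := left_adjoint_injective ((injective_projective Q).2 Qproj).
have wg : mweq g.
  by apply: (mweq_cancel_r (biproduct_mweq bi LQinj).1); rewrite gi1.
have [|h [hi gh]] := mcof_mtfib_lift ci fg wg (u := i1) (v := idm B).
  by rewrite gi1 mcomp1m.
by exists (idm A), (idm A), h, g; split; rewrite ?mcomp1m ?mcompm1.
Qed.

Lemma mtcof_mfib_lift A B X Y (i : mor A B) (p : mor X Y) :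
  mcof i -> mweq i -> mfib p -> has_lift i p.
Proof.
move=> ci wi fp; have [Q [W [i1 [i2 [p1 [p2 [Qproj bi ii1]]]]]]] :=
  mtcof_retract ci wi.
exact: has_lift_retract_l ii1 (biproduct_mfib_lift bi Qproj fp).
Qed.

Section Factorization.
Hypothesis counit_ker : forall M : C,
  exists (K : D) (j : mor K (R (L (R M)))),
    is_kernel j (fmap R (adj_counit adj M)) /\ injective_obj K.

(** Pull the conflation [X -> Y + IX -> M] back along the counit of [M].  A
    lift of [R p] against an inflation is found componentwise in the pullback:
    [R] of the counit is a retraction whose injective kernel absorbs the
    discrepancy between the section and the prescribed values. *)
Lemma mcof_mtfib_factor X Y (f : mor X Y) :
  exists (Z : C) (i : mor X Z) (p : mor Z Y),
    [/\ p \oc i = f, mcof i, mfib p & mweq p].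
Proof.
have [J [j0 [Jinj infj0]]] := enough_injectives X.
have [E [M [a [b [iY [iJ [pY [pJ [bi ab pYa _]]]]]]]]] := cone_conflation f infj0.
have [pYiY pJiJ pYiJ pJiY ip] := bi.
have [Z [f' [p' [i' [pb i'p' f'i']]]]] := conflation_pullback (adj_counit adj M) ab.
exists Z, i', (pY \oc f'); rewrite -mcompA f'i' pYa.
have [sq univ] := right_adjoint_pullback adj pb.
suff /inflation_lift_stable_iso [] : forall (A B : D) (i : mor A B),
    inflation i -> has_lift i (fmap R (pY \oc f')).
  by split=> //; apply: retracts_of_sub; exists (R M), p'.
move=> A B j infj u v uv.
have [w wj] := right_adjoint_injective Jinj (fmap R (pJ \oc f') \oc u) infj.
have [e eE] : exists e, e = fmap R iY \oc v + fmap R iJ \oc w by eexists.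
have ej : e \oc j = fmap R f' \oc u.
  rewrite eE mcompDl -!mcompA -uv wj !fmapM -!mcompA !(mcompA (fmap R iY)).
  by rewrite !(mcompA (fmap R iJ)) -!fmapM -mcompDl -R_exact.1 ip fmap1 mcomp1m.
have Re : fmap R pY \oc e = v.
  rewrite eE mcompDr !mcompA -!fmapM pYiY pYiJ (additive_fmap0 R_exact.1).
  by rewrite mcomp0m addr0 fmap1 mcomp1m.
have [K [c [[dc0 kerP] Kinj]]] := counit_ker M.
have [t tE] : exists t, t = fmap R b \oc e by eexists.
have dt : fmap R (adj_counit adj M) \oc (adj_unit adj (R M) \oc t) = t.
  by rewrite mcompA adj_triR mcomp1m.
have [|x [cx _]] := kerP _ (fmap R p' \oc u - adj_unit adj (R M) \oc t \oc j).
  rewrite mcompBr !mcompA adj_triR mcomp1m -sq -[X in X - _]mcompA -ej mcompA.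
  by rewrite -tE subrr.
have [x' x'j] := Kinj _ _ _ x infj.
have [g gE] : exists g, g = adj_unit adj (R M) \oc t + c \oc x' by eexists.
have [|h [[f'h p'h] _]] := univ _ e g.
  by rewrite gE mcompDr dt mcompA dc0 mcomp0m addr0.
exists h; split; last by rewrite fmapM -mcompA f'h.
have [|h' [_ h'P]] := univ _ (fmap R f' \oc u) (fmap R p' \oc u).
  by rewrite !mcompA sq.
rewrite -(h'P u) // -(h'P (h \oc j)) // !mcompA f'h p'h; split=> //.
by rewrite gE mcompDl -(mcompA c) x'j cx addrC subrK.
Qed.

Definition mmodel : model_structure C.
Proof.
refine (@ModelStructure C mweq mcof mfib mweq_comp mweq_cancel_l mweq_cancel_r
  mweq_retract _ mfib_retract mtcof_mfib_lift mcof_mtfib_lift mcof_mtfib_factor _).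
  by move=> X Y f; apply: retracts_of_retract.
move=> X Y f; have [Q [W [i1 [i2 [p1 [p2 [g [Qproj bi gi1 fg]]]]]]]] :=
  mtcof_mfib_factor f.
have LQinj := left_adjoint_injective ((injective_projective Q).2 Qproj).
exists W, i1, g; split=> //; first exact: biproduct_mcof bi.
exact: (biproduct_mweq bi LQinj).1.
Defined.

End Factorization.

(** * Fibrant and cofibrant objects *)

Lemma mfib_terminal X : mfib (0 : mor X (zob C)).
Proof.
move=> Q b _; exists 0; rewrite mcompm0; apply/esym/zero_obj_to.
by rewrite -fmap1 zobP (additive_fmap0 R_exact.1).
Qed.

Lemma is_terminal_zob : is_terminal (zob C).
Proof. by move=> X; exists 0 => g; apply: zero_obj_to (zobP C). Qed.

Lemma is_initial_zob : is_initial (zob C).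
Proof. by move=> X; exists 0 => g; apply: zero_obj_from (zobP C). Qed.

Lemma mcofibrantP X :
  (exists (Z : C) (f : mor Z X), is_initial Z /\ mcof f) <->
  exists N : D, direct_summand X (L N).
Proof.
split=> [[Z [f [Zinit [X' [Y' [g [[N [p gp]] fg]]]]]]]|[N [s [r rs]]]].
  have f0 : f = 0 by have [h hP] := Zinit X; rewrite (hP f) -(hP 0).
  have [_ [q [s' [r' [_ rs' _ fr]]]]] := fg.
  have [|t tp] := conflation_desc (f := r') gp; first by rewrite -fr f0 mcomp0m.
  by exists N, (p \oc s'), t; rewrite mcompA tp.
exists (zob C), 0; split; first exact: is_initial_zob.
exists (zob C), (L N), 0; split.
  by exists N, (idm (L N)); apply: conflation_zero_idm.
exists (idm _), (idm _), s, r.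
by split; rewrite ?mcomp1m ?mcompm0 ?mcomp0m.
Qed.

(** * The role of the chosen covers *)

Lemma retract_biproduct X Y Y' W W'
    (i1 : @mor C X W) (i2 : mor Y W) (p1 : mor W X) (p2 : mor W Y)
    (i1' : mor X W') (i2' : mor Y' W') (p1' : mor W' X) (p2' : mor W' Y') :
  is_biproduct i1 i2 p1 p2 -> is_biproduct i1' i2' p1' p2' ->
  direct_summand Y Y' -> retract_mor i1 i1'.
Proof.
move=> [p1i1 _ _ p2i1 ip] [p1i1' p2i2' p1i2' p2i1' _] [m [c cm]].
exists (idm X), (idm X), (i1' \oc p1 + i2' \oc m \oc p2),
  (i1 \oc p1' + i2 \oc c \oc p2').
split; rewrite ?mcompm1 //.
- rewrite mcompDr !mcompDl -!mcompA !(mcompA p1') !(mcompA p2').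
  rewrite p1i1' p1i2' p2i1' p2i2' !mcomp1m !mcomp0m !mcompm0 addr0 add0r.
  by rewrite (mcompA c) cm mcomp1m.
- by rewrite mcompDl -!mcompA p1i1 p2i1 !mcompm0 addr0 mcompm1.
- by rewrite mcompDl -!mcompA p1i1' p2i1' !mcompm0 addr0 mcompm1.
Qed.

Variable PC : projective_choice C.
Let PL (N : D) := proj_cover PC (L N).

Lemma projective_cover_summand (Q : D) :
  projective_obj Q -> direct_summand (L Q) (PL Q).
Proof.
move=> Qproj; have defc : deflation (cover_map PC (L Q)).
  by exists (desusp PC (L Q)), (desusp_map PC (L Q)); apply: cover_conflation.
have [m mE] := left_adjoint_projective Qproj (idm (L Q)) defc.
by exists m, (cover_map PC (L Q)).
Qed.

Hypothesis compat : cover_compatible L PC.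

(** The retraction of [L N'] onto [PL N] is covered by [L Q] for a projective
    cover [Q] of [N'], and [PL N] is projective. *)
Lemma cover_summand_projective (N : D) :
  exists2 Q : D, projective_obj Q & direct_summand (PL N) (L Q).
Proof.
have [N' [s [r rs]]] := compat N.
have [Q [d [Qproj [N'' [j jd]]]]] := enough_projectives N'.
have defLd : deflation (fmap L d).
  by exists (L N''), (fmap L j); apply: L_exact.2.
exists Q => //; have [m mE] := @cover_projective k C PC (L N) _ _ _ s defLd.
by exists m, (r \oc fmap L d); rewrite -mcompA mE.
Qed.

Lemma mfib_cover X Y (f : mor X Y) :
  mfib f <-> forall N : D, has_lift (0 : mor (zob C) (PL N)) f.
Proof.
split=> [ff N u v _|lf].
  have [Q Qproj [s [r rs]]] := cover_summand_projective N.
  have [l lE] := mfib_lift (v \oc r) ff Qproj.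
  exists (l \oc s); split; last by rewrite mcompA lE -mcompA rs mcompm1.
  by rewrite mcompm0 (zero_obj_from u (zobP C)).
apply: mfib_from_lift => Q v Qproj.
have [s [r rs]] := projective_cover_summand Qproj.
have [|l [_ lE]] := lf Q 0 (v \oc r); first by rewrite !mcompm0.
by exists (l \oc s); rewrite mcompA lE -mcompA rs mcompm1.
Qed.

Lemma mtcof_cover X Y (f : mor X Y) :
  mcof f /\ mweq f <-> retracts_of (inflations_onto PL) f.
Proof.
split=> [[cf wf]|[X' [Y' [g [[N [p gp]] fg]]]]].
  have [Q [W [i1 [i2 [p1 [p2 [Qproj bi fi1]]]]]]] := mtcof_retract cf wf.
  have [W' [i1' [i2' [p1' [p2' bi']]]]] := biproduct X (PL Q).
  exists X, W', i1'; split; last first.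
    apply: retract_mor_trans fi1 _.
    exact: retract_biproduct bi bi' (projective_cover_summand Qproj).
  by exists Q, p2'; apply: biproduct_conflation bi'.
have PLinj : injective_obj (PL N).
  by apply/injective_projective; apply: cover_projective.
have [t [r bi]] := conflation_injective_coker gp PLinj.
split; last first.
  apply: mweq_retract; exists X', Y', g; split=> //.
  exact: (biproduct_mweq bi PLinj).1.
apply: retracts_of_retract; exists X', Y', g; split=> //.
have [Q Qproj sQ] := cover_summand_projective N.
have [W' [i1' [i2' [p1' [p2' bi']]]]] := biproduct X' (L Q).
exists X', W', i1'; split; last exact: retract_biproduct bi bi' sQ.
by exists Q, p2'; apply: biproduct_conflation bi'.
Qed.

End Model.

(** * Triangle functors induced on stable categories *)

Lemma cokernel_map_unique (k : comPzRingType) (C : frobenius_cat k)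
    (X Y Z X' Y' Z' : C) (i : mor X Y) (p : mor Y Z)
    (i' : mor X' Y') (p' : mor Y' Z') (f1 f2 : mor X X') (g1 g2 : mor Y Y')
    (h1 h2 : mor Z Z') :
  conflation i p -> conflation i' p' -> injective_obj Y' ->
  g1 \oc i = i' \oc f1 -> h1 \oc p = p' \oc g1 ->
  g2 \oc i = i' \oc f2 -> h2 \oc p = p' \oc g2 ->
  stably_null (f1 - f2) -> stably_null (h1 - h2).
Proof.
move=> ip ip' Y'inj gi1 hp1 gi2 hp2.
apply: (cokernel_map_null (g := g1 - g2) ip (conflation0 ip') Y'inj).
  by rewrite mcompBl mcompBr gi1 gi2.
by rewrite mcompBl mcompBr hp1 hp2.
Qed.

Section StableFunctor.
Variables (k : comPzRingType) (C D : frobenius_cat k).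
Variables (IC : injective_choice C) (ID : injective_choice D).
Variables (F : functor C D).
Hypotheses (F_exact : exact_functor F).
Hypothesis F_inj : forall J : C, injective_obj J -> injective_obj (F J).
Implicit Types X Y Z : C.

Definition stab_fmap X Y (f : stab_hom X Y) : stab_hom (F X) (F Y) :=
  stab_proj (fmap F (stab_rep f)).

Lemma stab_fmapE X Y (f : mor X Y) : stab_fmap (stab_proj f) = stab_proj (fmap F f).
Proof.
apply/stab_projP; rewrite -(additive_fmapB F_exact.1).
by apply: fmap_stably_null => //; apply/stab_projP; rewrite stab_repK.
Qed.

Lemma stab_fmap1 X : stab_fmap (stab_idm X) = stab_idm (F X).
Proof. by rewrite stab_fmapE fmap1. Qed.

Lemma stab_fmapM X Y Z (g : stab_hom Y Z) (f : stab_hom X Y) :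
  stab_fmap (stab_comp g f) = stab_comp (stab_fmap g) (stab_fmap f).
Proof.
by rewrite -(stab_repK g) -(stab_repK f) stab_compE !stab_fmapE fmapM stab_compE.
Qed.

Definition stab_map : functor (stab C) (stab D) :=
  @Functor (stab C) (stab D) F stab_fmap stab_fmap1 stab_fmapM.

(** [F] sends the conflation defining [S X] to a conflation with injective
    middle term, to be compared with the one defining [S (F X)]. *)
Lemma suspension_comparison X :
  exists c : mor (F (susp IC X)) (susp ID (F X)),
    exists g : mor (F (inj_hull IC X)) (inj_hull ID (F X)),
    g \oc fmap F (hull_map IC X) = hull_map ID (F X) /\
    c \oc fmap F (susp_map IC X) = susp_map ID (F X) \oc g.
Proof.
have cf := F_exact.2 _ _ _ _ _ (hull_conflation IC X).
have infF : inflation (fmap F (hull_map IC X)).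
  by exists (F (susp IC X)), (fmap F (susp_map IC X)).
have [g gE] := @hull_injective k D ID (F X) _ _ _ (hull_map ID (F X)) infF.
have [|c cE] := conflation_desc (f := susp_map ID (F X) \oc g) cf.
  by rewrite -mcompA gE hull_comp0.
by exists c, g.
Qed.

Definition susp_comm X : mor (F (susp IC X)) (susp ID (F X)) :=
  sval (cid (suspension_comparison X)).

Definition stab_comm (X : stab C) :
    @mor (stab D) (stab_map (stab_shift IC X)) (stab_shift ID (stab_map X)) :=
  stab_proj (susp_comm X).

Lemma susp_commP X : exists g : mor (F (inj_hull IC X)) (inj_hull ID (F X)),
    g \oc fmap F (hull_map IC X) = hull_map ID (F X) /\
    susp_comm X \oc fmap F (susp_map IC X) = susp_map ID (F X) \oc g.
Proof. by rewrite /susp_comm; case: cid. Qed.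

Lemma stab_comm_natural :
  @natural (stab C) (stab D) (fcomp stab_map (stab_shift IC))
    (fcomp (stab_shift ID) stab_map) stab_comm.
Proof.
move=> X Y f; rewrite /= -(stab_repK f); set f0 := stab_rep f.
have [h fh] := susp_ex IC f0; have [h' fh'] := susp_ex ID (fmap F f0).
rewrite (stab_susp_morE fh) !stab_fmapE (stab_susp_morE fh') /stab_comm !stab_compE.
apply/stab_projP; have [a [ai ap]] := fh; have [a' [a'i a'p]] := fh'.
have [gX [gXi gXp]] := susp_commP X; have [gY [gYi gYp]] := susp_commP Y.
apply: (cokernel_map_unique (g1 := gY \oc fmap F a) (g2 := a' \oc gX)
  (f1 := fmap F f0) (f2 := fmap F f0) _ (hull_conflation ID (F Y))).
- exact: F_exact.2 _ _ _ _ _ (hull_conflation IC X).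
- exact: hull_injective.
- by rewrite -mcompA -fmapM ai fmapM mcompA gYi.
- by rewrite -mcompA -fmapM ap fmapM mcompA gYp mcompA.
- by rewrite -mcompA gXi a'i.
- by rewrite -mcompA gXp !mcompA a'p.
- by rewrite subrr; apply: stably_null0.
Qed.

Lemma stab_comm_iso X : is_iso (stab_comm X).
Proof.
apply/stable_isoP; have [g [gi gp]] := susp_commP X.
have cf := F_exact.2 _ _ _ _ _ (hull_conflation IC X).
have FIinj : injective_obj (F (inj_hull IC X)) by apply/F_inj/hull_injective.
have [g' g'i] := FIinj _ _ _ (fmap F (hull_map IC X)) (hull_inflation ID (F X)).
have [|c' c'p] := conflation_desc (f := fmap F (susp_map IC X) \oc g')
    (hull_conflation ID (F X)).
  by rewrite -mcompA g'i (conflation0 cf).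
exists c'; split.
  apply: (cokernel_map_unique (g1 := idm _) (g2 := g' \oc g)
    (f1 := idm (F X)) (f2 := idm (F X)) cf cf FIinj).
  - by rewrite mcomp1m mcompm1.
  - by rewrite mcomp1m mcompm1.
  - by rewrite -mcompA gi g'i mcompm1.
  - by rewrite -mcompA gp !mcompA c'p.
  - by rewrite subrr; apply: stably_null0.
apply: (cokernel_map_unique (g1 := idm _) (g2 := g \oc g')
  (f1 := idm (F X)) (f2 := idm (F X)) (hull_conflation ID (F X))
  (hull_conflation ID (F X))).
- exact: hull_injective.
- by rewrite mcomp1m mcompm1.
- by rewrite mcomp1m mcompm1.
- by rewrite -mcompA g'i gi mcompm1.
- by rewrite -mcompA c'p !mcompA gp.
- by rewrite subrr; apply: stably_null0.
Qed.

(** Standard triangles go to standard triangles: compose the image of the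
    extension [g] with the map inducing the comparison of suspensions. *)
Lemma stab_map_triangle (X Y Z : stab C)
    (u : mor X Y) (v : mor Y Z) (w : mor Z (stab_shift IC X)) :
  stab_triangle u v w ->
  stab_triangle (fmap stab_map u) (fmap stab_map v)
    (stab_comm X \oc fmap stab_map w).
Proof.
move=> [X' [Y' [Z' [u' [v' [w' [std [a [b [c [[isoa isob isoc] [bu cv aw]]]]]]]]]]]].
exists (stab_map X'), (stab_map Y'), (stab_map Z'), (fmap stab_map u'),
  (fmap stab_map v'),
  (stab_comm X' \oc fmap stab_map w'); split; last first.
  exists (fmap stab_map a), (fmap stab_map b), (fmap stab_map c).
  split; first by split; apply: fmap_iso.
  split; [by rewrite -!fmapM bu | by rewrite -!fmapM cv |].
  rewrite mcompA -[X in X \oc _](stab_comm_natural a) -!mcompA; congr (_ \oc _).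
  by rewrite -fmapM -aw fmapM.
have [i [p [g [e [[ip gi ep] [-> -> ->]]]]]] := std.
have [l [li lp]] := susp_commP X'.
exists (fmap F i), (fmap F p), (l \oc fmap F g), (susp_comm X' \oc fmap F e).
split; last by rewrite /= /stab_comm !stab_fmapE stab_compE.
split; first exact: F_exact.2.
- by rewrite -mcompA -fmapM gi li.
- by rewrite -mcompA -fmapM ep fmapM mcompA lp mcompA.
Qed.

Definition stab_tri_functor (F_lin : klinear_functor stab_map) :
    tri_functor (stab_tricat IC) (stab_tricat ID) :=
  @TriFunctor k (stab_tricat IC) (stab_tricat ID) stab_map F_lin stab_comm
    stab_comm_natural stab_comm_iso stab_map_triangle.

End StableFunctor.

Section TriangleFunctors.
Variables (k : comPzRingType) (A B : tricat k).

Section Corestriction.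
Variables (F : tri_functor A B) (P : B -> Prop).
Hypothesis P_shift : forall X : B, P X -> P (tri_shift B X).
Hypothesis FP : forall X : A, P (F X).

Let T := full_tricat P_shift.

Definition corestrict : functor A T :=
  @Functor A T (fun X => exist P (F X) (FP X)) (fun X Y f => fmap F f)
    (fun X => fmap1 F X) (fun X Y Z g f => fmapM F g f).

Definition tri_corestrict : tri_functor A T :=
  @TriFunctor k A T corestrict (@tri_fun_linear _ _ _ F)
    (fun X => tri_comm F X)
    (fun X Y f => tri_comm_natural F f) (fun X => tri_comm_isom F X)
    (fun X Y Z u v w => @tri_fun_triangle _ _ _ F X Y Z u v w).

End Corestriction.

Lemma triangle_equivalent_refl : triangle_equivalent A A.
Proof.
have lin : klinear_functor (fid A) by [].
have nat : @natural A A (fcomp (fid A) (tri_shift A)) (fcomp (tri_shift A) (fid A))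
    (fun X => idm (tri_shift A X)).
  by move=> X Y f; rewrite mcomp1m mcompm1.
have iso (X : A) : is_iso (idm (tri_shift A X)) by apply: is_iso_idm.
have tri (X Y Z : A) (u : mor X Y) (v : mor Y Z) (w : mor Z (tri_shift A X)) :
    triangle u v w -> triangle u v (idm (tri_shift A X) \oc w).
  by rewrite mcomp1m.
exists (@TriFunctor k A A (fid A) lin _ nat iso tri).
split=> [X Y g|Y]; first by exists g; split.
by exists Y, (idm Y); apply: is_iso_idm.
Qed.

End TriangleFunctors.

Section StableTriangulated.
Variables (k : comPzRingType) (C : frobenius_cat k) (IC : injective_choice C).

Lemma stab_triangulated_subcat (P : stab_tricat IC -> Prop) :
  (forall J : C, injective_obj J -> P J) ->
  (forall X Y : stab C, is_isomorphic X Y -> P X -> P Y) ->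
  (forall (X Y Z : C) (i : mor X Y) (p : mor Y Z), conflation i p ->
     [/\ P X -> P Y -> P Z, P Y -> P Z -> P X & P X -> P Z -> P Y]) ->
  triangulated_subcat P.
Proof.
move=> Pinj Piso Pconf; split=> //.
- by move=> X X0; apply/Pinj/stably_null_idm/stably_nullE.
- move=> X; have [P1 P2 _] := Pconf _ _ _ _ _ (hull_conflation IC X).
  have PI := Pinj _ (@hull_injective k C IC X).
  by split=> [PX|PS]; [apply: P1|apply: P2].
- move=> X Y Z u v w [X' [Y' [Z' [u' [v' [w' [[i [p [g [e [[ip _ _] _]]]]]
    [a [b [c [[isoa isob isoc] _]]]]]]]]]]].
  have P_iso (U V : stab C) (f : mor U V) : is_iso f -> P U = P V.
    move=> isof; apply: propext; split; apply: Piso; first by exists f.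
    by have [f' [ff' f'f]] := isof; exists f', f.
  by rewrite -(P_iso _ _ _ isoa) -(P_iso _ _ _ isob) -(P_iso _ _ _ isoc);
    apply: Pconf ip.
Qed.

(** Any morphism is stably isomorphic to the inflation of its cone. *)
Lemma cone_triangle (X Y : C) (f : mor X Y) :
  exists (E M : C) (a : mor X E) (b : mor E M) (q : mor E Y)
      (v : @mor (stab C) Y M) (w : @mor (stab C) M (stab_shift IC X)),
    [/\ conflation a b, q \oc a = f,
        exists (J : C) (iY : mor Y E) (iJ : mor J E) (pJ : mor E J),
          is_biproduct iY iJ q pJ /\ injective_obj J
      & @triangle k (stab_tricat IC) X Y M (stab_proj f) v w].
Proof.
have [E [M [a [b [iY [iJ [q [pJ [bi ab qa pa]]]]]]]]] :=
  cone_conflation f (hull_inflation IC X).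
have Jinj := @hull_injective k C IC X.
have [|e eb] := conflation_desc (f := susp_map IC X \oc pJ) ab.
  by rewrite -mcompA pa hull_comp0.
exists E, M, a, b, q, (stab_proj (b \oc iY)), (stab_proj e); split=> //.
  by exists (inj_hull IC X), iY, iJ, pJ.
exists X, E, M, (stab_proj a), (stab_proj b), (stab_proj e); split.
  by exists a, b, pJ, e.
exists (idm (X : stab C)), (stab_proj q), (idm (M : stab C)); split.
  split; try exact: is_iso_idm.
  exact: (stable_iso_biproduct bi Jinj).2.
split.
- by rewrite mcompm1; apply: etrans (stab_compE _ _) _; rewrite qa.
- rewrite mcomp1m; apply: esym; apply: etrans (stab_compE _ _) _.
  apply/stab_projP; have [_ _ _ _ ip] := bi.
  rewrite -[X in _ - X]mcompm1 -ip mcompDr mcompA opprD addrA subrr sub0r.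
  by apply: stably_nullN; exists (inj_hull IC X), pJ, (b \oc iJ); rewrite -mcompA.
- by rewrite fmap1 mcomp1m mcompm1.
Qed.

End StableTriangulated.

(** * Localizations *)

(** A coreflection onto a subcategory is a localization: functors inverting the
    coreflections [eps] are determined by their restriction along [J]. *)
Lemma coreflective_localization (A B : category) (J : functor B A)
    (Q : functor A B) (W : mor_class A)
    (eps : forall X : A, mor (J (Q X)) X) (theta : forall X : B, mor (Q (J X)) X) :
  @natural A A (fcomp J Q) (fid A) eps ->
  @natural B B (fcomp Q J) (fid B) theta ->
  (forall X : B, is_iso (theta X)) ->
  (forall X : A, fmap Q (eps X) = theta (Q X)) ->
  (forall X : A, W _ _ (eps X)) ->
  (forall (X Y : A) (f : mor X Y), W X Y f -> is_iso (fmap Q f)) ->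
  is_localization W Q.
Proof.
move=> eps_nat theta_nat theta_iso Qeps Weps WQ; split=> //.
  move=> X F FW; exists (fcomp F J), (fun A0 : A => fmap F (eps A0)).
  split=> [A0 A1 f|A0]; last exact: FW.
  by rewrite /= -!fmapM; congr fmap; apply: eps_nat.
move=> X G H a a_nat.
have thetaN (Y Y' : B) (f : mor Y Y') :
  theta Y' \oc fmap Q (fmap J f) = f \oc theta Y by exact: theta_nat.
have aN (Y Y' : A) (f : mor Y Y') :
  a Y' \oc fmap G (fmap Q f) = fmap H (fmap Q f) \oc a Y by exact: a_nat.
pose inv Y := sval (cid (theta_iso Y)).
have invP Y : inv Y \oc theta Y = idm _ /\ theta Y \oc inv Y = idm _.
  by rewrite /inv; case: cid.
have inv_nat (Y Y' : B) (f : mor Y Y') :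
    inv Y' \oc f = fmap Q (fmap J f) \oc inv Y.
  rewrite -[LHS]mcompm1 -(invP Y).2 -!mcompA (mcompA f) -thetaN.
  by rewrite !mcompA (invP Y').1 mcomp1m.
exists (fun Y => fmap H (theta Y) \oc a (J Y) \oc fmap G (inv Y)); split.
- move=> Y Y' f; rewrite -mcompA -fmapM inv_nat fmapM !mcompA.
  by rewrite -(mcompA _ (a _)) aN !mcompA -!fmapM thetaN.
- move=> Y; rewrite -Qeps -aN Qeps.
  by rewrite -mcompA -fmapM (invP _).2 fmap1 mcompm1.
- move=> b b_nat bE Y.
  by rewrite -bE -b_nat -mcompA -fmapM (invP _).2 fmap1 mcompm1.
Qed.

(** A functor inverting the projections along injectives does not distinguish
    [f] and [f + v u]: the sections [(1, 0)] and [(1, u)] of such a projection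
    become equal. *)
Lemma inverting_stable (k : comPzRingType) (C : frobenius_cat k) (X : category)
    (F : functor C X) :
  (forall (A B E : C) (i1 : mor A E) (i2 : mor B E) (p1 : mor E A) (p2 : mor E B),
     is_biproduct i1 i2 p1 p2 -> injective_obj B -> is_iso (fmap F p1)) ->
  forall (A B : C) (f g : mor A B),
    stab_proj f = stab_proj g -> fmap F f = fmap F g.
Proof.
move=> Fp A B f g /stab_projP [J [u [v [Jinj fg]]]].
have [E [i1 [i2 [p1 [p2 bi]]]]] := biproduct A J.
have [q [qp _]] := Fp _ _ _ _ _ _ _ bi Jinj.
have [p1i1 p2i2 p1i2 p2i1 _] := bi.
have mf : (g \oc p1 + v \oc p2) \oc (i1 + i2 \oc u) = f.
  rewrite mcompDl !mcompDr -!mcompA !(mcompA p1) !(mcompA p2) p1i1 p1i2 p2i1 p2i2.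
  by rewrite mcompm1 mcomp0m !mcompm0 addr0 add0r mcomp1m -fg addrC subrK.
have mg : (g \oc p1 + v \oc p2) \oc i1 = g.
  by rewrite mcompDl -!mcompA p1i1 p2i1 mcompm1 mcompm0 addr0.
rewrite -mf -[in RHS]mg !fmapM; congr (_ \oc _).
rewrite -[LHS]mcomp1m -[RHS]mcomp1m -qp -!mcompA; congr (_ \oc _).
by rewrite -!fmapM mcompDr mcompA p1i1 p1i2 mcomp0m addr0.
Qed.

Lemma stab_localization (k : comPzRingType) (C : frobenius_cat k) (E : category)
    (Wst : mor_class (stab C)) (W : mor_class C) (Q : functor (stab C) E) :
  is_localization Wst Q ->
  (forall (X Y : C) (f : mor X Y), W X Y f -> is_iso (fmap Q (stab_proj f))) ->
  (forall (X Y : C) (f : mor X Y), Wst X Y (stab_proj f) -> W X Y f) ->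
  (forall (A B S : C) (i1 : mor A S) (i2 : mor B S) (p1 : mor S A) (p2 : mor S B),
     is_biproduct i1 i2 p1 p2 -> injective_obj B -> W S A p1) ->
  is_localization W (fcomp Q (stab_functor C)).
Proof.
move=> [_ Qfull Quniv] WQ WstW Wp; split=> // [X F FW|X G H a a_nat].
  have Fst : forall (A B : C) (f g : mor A B),
      stab_proj f = stab_proj g -> fmap F f = fmap F g.
    apply: inverting_stable => A B S i1 i2 p1 p2 bi Binj.
    exact/FW/(Wp _ _ _ _ _ _ _ bi).
  have F1 (A : C) : fmap F (stab_rep (stab_idm A)) = idm (F A).
    by rewrite -fmap1; apply: Fst; rewrite stab_repK.
  have FM (A0 A1 A2 : C) (g : stab_hom A1 A2) (f : stab_hom A0 A1) :
      fmap F (stab_rep (stab_comp g f)) = fmap F (stab_rep g) \oc fmap F (stab_rep f).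
    by rewrite -fmapM; apply: Fst; rewrite stab_repK.
  pose F' := @Functor (stab C) X F (fun A B f => fmap F (stab_rep f)) F1 FM.
  have [|G [a [a_nat a_iso]]] := Qfull X F'.
    by move=> A B f Wf; apply/FW/WstW; rewrite stab_repK.
  exists G, a; split=> // A B f; rewrite [LHS](a_nat A B (stab_proj f)) /=.
  by congr (_ \oc _); apply: Fst; rewrite stab_repK.
apply: Quniv => A B f; rewrite -(stab_repK f); exact: a_nat.
Qed.

(** * The stable coreflection *)

Section StableCoreflection.
Variables (k : comPzRingType) (C D : frobenius_cat k) (IC : injective_choice C).
Variables (L : functor D C) (R : functor C D).
Hypotheses (L_exact : exact_functor L) (R_exact : exact_functor R).
Variable adj : adjunction L R.
Hypothesis counit_ker : forall M : C,
  exists (K : D) (j : mor K (R (L (R M)))),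
    is_kernel j (fmap R (adj_counit adj M)) /\ injective_obj K.

Let d M := adj_counit adj M.
Let R_inj := right_adjoint_injective L_exact adj.
Let L_inj := left_adjoint_injective R_exact adj.

Lemma transpose_stably_null N M (f : mor (L N) M) :
  stably_null (transpose adj f) <-> stably_null f.
Proof.
split=> fN; last by apply/stably_null_compr/(fmap_stably_null R_inj).
rewrite -(transposeK adj f); apply/stably_null_compl.
exact: fmap_stably_null fN.
Qed.

Lemma counit_stable_retract M :
  stably_null (idm (R (L (R M))) - adj_unit adj (R M) \oc fmap R (d M)).
Proof.
have [K [j [[_ kerP] Kinj]]] := counit_ker M.
have [|x [<- _]] := kerP _ (idm (R (L (R M))) - adj_unit adj (R M) \oc fmap R (d M)).
  by rewrite mcompBr mcompm1 mcompA adj_triR mcomp1m subrr.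
by exists K, x, j.
Qed.

Lemma counit_stable_iso M : stable_iso (fmap R (d M)).
Proof.
by have [_] := stable_iso_section (adj_triR adj M) (counit_stable_retract M).
Qed.

(** The counit is a stable monomorphism for maps out of the [L N]: transpose
    and cancel the stable isomorphism [R (d M)]. *)
Lemma counit_cancel_null N M (f : mor (L N) (L (R M))) :
  stably_null (d M \oc f) -> stably_null f.
Proof.
move/transpose_stably_null; rewrite transpose_compl => dfN.
apply/transpose_stably_null.
rewrite -[transpose adj f]mcomp1m -(subrK (adj_unit adj (R M) \oc fmap R (d M)) (idm _)).
rewrite mcompDl; apply: stably_nullD.
  by apply: stably_null_compr; apply: counit_stable_retract.
by rewrite -mcompA; apply: stably_null_compl.
Qed.

Lemma counit_stable_section X (t : mor X (L (R X))) :
  stably_null (idm X - d X \oc t) -> stable_iso (d X).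
Proof.
move=> dt; apply/stable_isoP; exists t; split=> //.
apply: counit_cancel_null; rewrite mcompBr mcompm1 mcompA.
by rewrite -{1}[d X]mcomp1m -mcompBl; apply: stably_null_compr.
Qed.

Lemma right_orthogonalP M :
  @right_orthogonal k (stab C) D (fun N => L N) M <-> injective_obj (R M).
Proof.
split=> [perp|RMinj N f].
  apply/stably_null_idm; rewrite -(adj_triR adj M).
  by apply/transpose_stably_null/stably_nullE/perp.
rewrite -(stab_repK f); apply/stably_nullE/transpose_stably_null.
exact: stably_null_to_injective.
Qed.

(** * The triangulated subcategory generated by the image of [L] *)

(** The left orthogonal, in the stable category, of the objects which [R]
    annihilates. *)
Definition colocal (X : C) :=
  forall (M : C) (f : mor X M), injective_obj (R M) -> stably_null f.

Lemma colocal_L N : colocal (L N).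
Proof.
by move=> M f RMinj; apply/transpose_stably_null; apply: stably_null_to_injective.
Qed.

(** The cone of [d X] is annihilated by [R]; a map from a colocal [X] to it
    vanishes, which splits [d X]. *)
Lemma colocal_section X :
  colocal X -> exists t : mor X (L (R X)), stably_null (idm X - d X \oc t).
Proof.
move=> Xcol.
have [E [M [a [b [q [_ [_ [ab qa [J [i [j [p [bi Jinj]]]]] _]]]]]]]] :=
  cone_triangle IC (d X).
have RMinj : injective_obj (R M).
  apply/(stable_iso_conflation (R_exact.2 _ _ _ _ _ ab)).
  have Rq : stable_iso (fmap R q).
    by have [] := biproduct_mweq L_exact R_exact adj bi Jinj.
  apply: is_iso_cancel_l Rq _; rewrite -fmapM -[_ \oc _]fmapM qa.
  exact: counit_stable_iso.
(* [i] embeds [X] in [E]; corrected by [g] it lands in the kernel of [b]. *)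
have [g [bg gN]] := stably_null_lift ab (Xcol M (b \oc i) RMinj).
have [|t tE] := conflation_lift (f := i - g) ab; first by rewrite mcompBr bg subrr.
exists t; have [qi _ _ _ _] := bi.
rewrite -qa -mcompA tE mcompBr qi opprB addrC subrK.
exact: stably_null_compl.
Qed.

Lemma colocal_counit X : colocal X -> stable_iso (d X).
Proof. by move=> /colocal_section [t]; apply: counit_stable_section. Qed.

Lemma colocal_summand (X Y : stab C) : direct_summand X Y -> colocal Y -> colocal X.
Proof.
move=> [s [r rs]] Ycol M f RMinj; apply/stably_nullE.
have /(congr1 (fun h : stab_hom X X => stab_comp (stab_proj f) h)) := rs.
rewrite stab_compm1 => <-; rewrite stab_compA -(stab_repK r) stab_compE.
rewrite (stably_nullE _).1; last exact: Ycol.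
exact: (@mcomp0m k (stab C) _ _ _ s).
Qed.

Lemma colocal_conflation X Y Z (i : mor X Y) (p : mor Y Z) : conflation i p ->
  [/\ colocal X -> colocal Y -> colocal Z, colocal Y -> colocal Z -> colocal X
    & colocal X -> colocal Z -> colocal Y].
Proof.
apply: (left_orthogonal_conflation (K := fun M => injective_obj (R M))).
move=> A B M j q jq Binj; have RBinj := R_inj Binj.
have [P1 P2 P3] := injective_conflation (R_exact.2 _ _ _ _ _ jq).
by split=> [RA|RM]; [apply: P1|apply: P2].
Qed.

Lemma iso_summand (A : category) (X Y : A) : is_isomorphic X Y -> direct_summand Y X.
Proof. by move=> [f [g [gf fg]]]; exists g, f. Qed.

Lemma colocal_triangulated : @triangulated_subcat k (stab_tricat IC) colocal.
Proof.
apply: stab_triangulated_subcat.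
- by move=> J Jinj M f _; apply: stably_null_from_injective.
- by move=> X Y /iso_summand; apply: colocal_summand.
- exact: colocal_conflation.
Qed.

Lemma colocal_coproduct : @coproduct_closed (stab C) colocal.
Proof.
move=> I X Y e eP Xcol M f RMinj; apply/stably_nullE.
have [g [_ gP]] := eP (M : stab C) (fun i => 0).
rewrite -(gP (stab_proj f)); first by apply: gP => i; apply: mcomp0m.
move=> i; rewrite -(stab_repK (e i)); apply: etrans (stab_compE _ _) _.
by apply/stably_nullE; apply: Xcol.
Qed.

Lemma perp_triangulated :
  @triangulated_subcat k (stab_tricat IC)
    (@right_orthogonal k (stab C) D (fun N => L N)).
Proof.
apply: stab_triangulated_subcat.
- by move=> J Jinj; apply/right_orthogonalP/R_inj.
- move=> X Y [f [g [gf fg]]] perp N h.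
  by rewrite -[h]mcomp1m -fg -mcompA (perp N (g \oc h)) mcompm0.
- move=> X Y Z i p ip.
  have [P1 P2 P3] := injective_conflation (R_exact.2 _ _ _ _ _ ip).
  by split=> /right_orthogonalP U /right_orthogonalP V; apply/right_orthogonalP;
    [apply: P1|apply: P2|apply: P3].
Qed.

Let isLN : stab_tricat IC -> Prop := fun X => exists N : D, X = L N.

Lemma Tria_LN N : Tria isLN (L N : stab_tricat IC).
Proof. by move=> P _ _; apply; exists N. Qed.

(** Colocal objects are closed under triangles and coproducts and contain the
    [L N]; conversely a colocal [X] is stably isomorphic to [L (R X)]. *)
Lemma Tria_colocal (X : stab_tricat IC) : Tria isLN X <-> colocal X.
Proof.
split=> [TX|Xcol].
  apply: TX; [exact: colocal_triangulated|exact: colocal_coproduct|].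
  by move=> _ [N ->]; apply: colocal_L.
move=> P tP cP GP; apply: (tsub_isom tP) (GP (L (R X)) _); last by exists (R X).
by exists (stab_proj (d X)); apply: colocal_counit.
Qed.

Lemma Tria_summand (X : stab_tricat IC) :
  Tria isLN X <-> exists N : D, direct_summand X (L N : stab_tricat IC).
Proof.
split=> [/Tria_colocal Xcol|[N XN]]; last first.
  by apply/Tria_colocal; apply: colocal_summand XN _; apply: colocal_L.
exists (R X); have [g [gd dg]] := colocal_counit Xcol.
by exists g, (stab_proj (d X)).
Qed.

(** * The quotient functor *)

Let G : functor C C := fcomp L R.

Lemma LR_exact : exact_functor G.
Proof.
split=> [X Y f g|X Y Z i p ip]; first by rewrite /= R_exact.1 L_exact.1.
by apply: L_exact.2; apply: R_exact.2.
Qed.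

Lemma LR_inj (J : C) : injective_obj J -> injective_obj (G J).
Proof. by move=> Jinj; apply/L_inj/R_inj. Qed.

Let stabLR : functor (stab C) (stab C) := stab_map LR_exact LR_inj.

Definition stab_counit (X : stab C) : @mor (stab C) (stabLR X) X := stab_proj (d X).

Lemma stab_counit_natural : @natural (stab C) (stab C) stabLR (fid (stab C)) stab_counit.
Proof.
move=> X Y f; rewrite -(stab_repK f) /= (stab_fmapE LR_exact LR_inj).
by rewrite /stab_counit !stab_compE counit_natE.
Qed.

Lemma stab_counit_cancel N (Y : stab C) (f g : @mor (stab C) (L N) (stabLR Y)) :
  stab_counit Y \oc f = stab_counit Y \oc g -> f = g.
Proof.
rewrite -(stab_repK f) -(stab_repK g) /= !stab_compE => /stab_projP.
by rewrite -mcompBr => /counit_cancel_null fg; apply/stab_projP.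
Qed.

(** The functors [L] and [R] are additive, and linearity of the composite comes
    from its natural map to the identity, which is stably monic on maps out of
    the [L N]. *)
Lemma stabLR_linear : klinear_functor stabLR.
Proof.
move=> X Y a f g; apply: (@stab_counit_cancel (R X) Y).
rewrite mcompPr !(stab_counit_natural) /=; exact: (mcompPl (A := stab C)).
Qed.

(** Both sides are induced on cokernels by maps extending [d X]. *)
Lemma stab_counit_shift (X : stab C) :
  fmap (stab_shift IC) (stab_counit X) \oc stab_comm IC IC LR_exact LR_inj X =
  stab_counit (susp IC X).
Proof.
have [h dh] := susp_ex IC (d X); have [g [gi hp]] := dh.
have [l [li lp]] := susp_commP IC IC LR_exact X.
rewrite /= /stab_counit (stab_susp_morE dh) /stab_comm stab_compE.
apply/stab_projP.
apply: (cokernel_map_unique (g1 := g \oc l) (g2 := d (inj_hull IC X))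
  (f1 := d X) (f2 := d X) _ (hull_conflation IC X)).
- exact: (LR_exact.2 _ _ _ _ _ (hull_conflation IC X)).
- exact: hull_injective.
- by rewrite -mcompA li gi.
- by rewrite -mcompA lp !mcompA hp.
- exact: counit_natE.
- exact: counit_natE.
- by rewrite subrr; apply: stably_null0.
Qed.

Let T := Tria_cat isLN.

Definition Tria_quotient : tri_functor (stab_tricat IC) T :=
  tri_corestrict (F := stab_tri_functor IC IC stabLR_linear)
    (@Tria_shift k (stab_tricat IC) isLN) (fun X => Tria_LN (R X)).

Definition Tria_incl : functor T (stab C) :=
  @Functor T (stab C) (fun X => sval X) (fun X Y f => f)
    (fun X => erefl) (fun X Y Z g f => erefl).

Lemma iso_Tria (X Y : T) (f : @mor (stab C) (sval X) (sval Y)) :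
  is_iso f -> @is_iso T X Y f.
Proof. by []. Qed.

Lemma stab_counit_iso (X : T) : is_iso (stab_counit (sval X)).
Proof.
have Xcol : colocal (sval X) by apply/Tria_colocal; exact: svalP X.
exact: (colocal_counit Xcol).
Qed.

Let W : mor_class (stab C) := fun X Y f =>
  exists (Z : stab_tricat IC) (v : mor Y Z) (w : mor Z (tri_shift (stab_tricat IC) X)),
    @triangle k (stab_tricat IC) X Y Z f v w /\
    @right_orthogonal k (stab C) D (fun N => L N) Z.

Let sR : functor (stab C) (stab D) := stab_map R_exact R_inj.

(** The maps with cone in the orthogonal are those inverted by [R]. *)
Lemma cone_perp_iso (X Y : stab C) (f : mor X Y) : W f <-> is_iso (fmap sR f).
Proof.
split=> [[Z [v [w [tri perp]]]]|].
  have [X' [Y' [Z' [u' [v' [w' [[i [p [g [e [[ip _ _] [u'E _ _]]]]]] abc]]]]]]] := tri.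
  have [a [b [c [[isoa isob [c' [c'c _]]] [bu _ _]]]]] := abc.
  have RZinj : injective_obj (R Z').
    apply/right_orthogonalP => N h.
    by rewrite -[h]mcomp1m -c'c -mcompA (perp N (c \oc h)) mcompm0.
  have u'_iso : is_iso (fmap sR u').
    rewrite u'E /= (stab_fmapE R_exact R_inj).
    exact/(stable_iso_conflation (R_exact.2 _ _ _ _ _ ip)).
  apply: is_iso_cancel_r (fmap_iso sR isoa) _.
  rewrite -[_ \oc _]fmapM -bu fmapM.
  by apply: is_iso_comp => //; apply: fmap_iso.
rewrite -(stab_repK f) /= (stab_fmapE R_exact R_inj) => Rf.
have [E [M [a [b [q [v [w [ab qa [J [i [j [p [bi Jinj]]]]] tri]]]]]]]] :=
  cone_triangle IC (stab_rep f).
exists M, v, w; split=> //; apply/right_orthogonalP.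
apply/(stable_iso_conflation (R_exact.2 _ _ _ _ _ ab)).
have Rq : stable_iso (fmap R q).
  by have [] := biproduct_mweq L_exact R_exact adj bi Jinj.
by apply: is_iso_cancel_l Rq _; rewrite -[_ \oc _]fmapM -fmapM qa.
Qed.

(** On a colocal object the counit is invertible, so the quotient functor and
    the inclusion form a coreflection. *)
Lemma Tria_quotient_localization : is_localization W Tria_quotient.
Proof.
apply: (@coreflective_localization (stab C) T Tria_incl Tria_quotient W
  stab_counit (fun X => stab_counit (sval X))).
- exact: stab_counit_natural.
- by move=> X Y f; apply: stab_counit_natural.
- exact: stab_counit_iso.
- move=> X; apply: (@stab_counit_cancel (R (L (R X))) X).
  exact: (stab_counit_natural (stab_counit X)).
- move=> X; apply/cone_perp_iso; rewrite /= (stab_fmapE R_exact R_inj).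
  exact: counit_stable_iso.
- move=> X Y f /cone_perp_iso Rf; apply: iso_Tria.
  move: Rf; rewrite -(stab_repK f) /= (stab_fmapE R_exact R_inj).
  rewrite (stab_fmapE LR_exact LR_inj) => Rf.
  exact: (fmap_stable_iso L_inj L_exact.1 Rf).
Qed.

Lemma Tria_quotient_triangle_quotient :
  @is_triangle_quotient k (stab_tricat IC)
    (@right_orthogonal k (stab C) D (fun N => L N)) T Tria_quotient.
Proof.
split; first exact: Tria_quotient_localization.
move=> X Y Z u v w tri; exists (sval X), (sval Y), (sval Z), u, v, w; split=> //.
exists (stab_counit (sval X)), (stab_counit (sval Y)), (stab_counit (sval Z)).
split; first by split; apply: stab_counit_iso.
split; try exact: stab_counit_natural.
rewrite mcompA.
apply: etrans (congr1 (fun h => mcomp h _) (stab_counit_shift (sval X))) _.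
exact: stab_counit_natural.
Qed.

Lemma mweq_localization :
  is_localization (mweq R) (fcomp Tria_quotient (stab_functor C)).
Proof.
apply: stab_localization Tria_quotient_localization _ _ _.
- move=> X Y f wf; apply: iso_Tria; rewrite /= (stab_fmapE LR_exact LR_inj).
  exact: (fmap_stable_iso L_inj L_exact.1 wf).
- by move=> X Y f /cone_perp_iso; rewrite /= (stab_fmapE R_exact R_inj).
- move=> A B S i1 i2 p1 p2 bi Binj.
  exact: (biproduct_mweq L_exact R_exact adj bi Binj).2.
Qed.

End StableCoreflection.

Theorem mainTheorem1 (k : comPzRingType) (C D : frobenius_cat k)
    (IC : injective_choice C) (PC : projective_choice C)
    (L : functor D C) (R : functor C D)
    (L_exact : exact_functor L) (R_exact : exact_functor R)
    (adj : adjunction L R)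
    (counit_ker : forall M : C,
       exists (K : D) (j : mor K (R (L (R M)))),
         is_kernel j (fmap R (adj_counit adj M)) /\ injective_obj K) :
  let LN : D -> C := fun N => L N in
  let PLN : D -> C := fun N => proj_cover PC (L N) in
  let LN_perp : stab_tricat IC -> Prop := @right_orthogonal k (stab C) D LN in
  let isLN : stab_tricat IC -> Prop := fun X => exists N : D, X = L N in
  (exists M : model_structure C,
     (* a) *)
     (forall (X Y : C) (f : mor X Y),
        cof M f <-> retracts_of (inflations_onto LN) f) /\
     (* b) *)
     (cover_compatible L PC ->
      forall (X Y : C) (f : mor X Y),
        fib M f <->
        forall N : D, has_lift (0 : mor (zob C) (PLN N)) f) /\
     (* c) *)
     (forall (X Y : C) (f : mor X Y), weq M f <-> stable_iso (fmap R f)) /\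
     (forall X : C, fibrant M X) /\
     (forall X : C, cofibrant M X <-> exists N : D, direct_summand X (L N)) /\
     (* d) *)
     (cover_compatible L PC ->
      forall (X Y : C) (f : mor X Y),
        (cof M f /\ weq M f) <-> retracts_of (inflations_onto PLN) f) /\
     (* e) *)
     (forall (X Y : C) (f : mor X Y),
        (fib M f /\ weq M f) <->
        forall N : D, has_lift (desusp_map PC (L N)) f) /\
     triangulated_subcat LN_perp /\
     exists (T : tricat k) (Q : tri_functor (stab_tricat IC) T),
       is_triangle_quotient LN_perp Q /\
       is_localization (@weq C M) (fcomp Q (stab_functor C)) /\
       triangle_equivalent T (Tria_cat isLN)) /\
  (forall X : stab_tricat IC,
     Tria isLN X <-> exists N : D, direct_summand X (L N : stab_tricat IC)).
Proof.
move=> LN PLN LN_perp isLN; split;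
  last exact: (Tria_summand L_exact R_exact counit_ker).
exists (mmodel L_exact R_exact counit_ker).
split=> //; split; first exact: (mfib_cover L_exact R_exact adj).
split=> //; split.
  move=> X; exists (zob C), 0; split; first exact: is_terminal_zob.
  exact: (mfib_terminal R_exact).
split; first by move=> X; exact: mcofibrantP.
split; first exact: (mtcof_cover L_exact R_exact adj).
split; first exact: (mtfib_cover L_exact R_exact adj).
split; first exact: (perp_triangulated IC L_exact R_exact adj).
exists (Tria_cat isLN), (Tria_quotient IC L_exact R_exact counit_ker).
split; first exact: Tria_quotient_triangle_quotient.
split; first exact: mweq_localization.
exact: triangle_equivalent_refl.
Qed.
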